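(* Let $\mathbf{Z},\mathbf{Z}_1,\mathbf{Z}_2,\dots$ be i.i.d. $\mathbb{R}^d$-valued random vectors with $\mathbf{Z}\in\mathrm{RV}(\alpha,\mu)$ for some $\alpha>1$ and $\mathrm{E}(\mathbf{Z})=\mathbf{0}$. Let $\mathbf{S}_0=\mathbf{0}$, $\mathbf{S}_n=\mathbf{Z}_1+\cdots+\mathbf{Z}_n$, and for $A\in\mathcal{B}(\mathbb{R}^d)$ let $$R_n(A)=\sup\{k:\ \mathbf{S}_{i+k}-\mathbf{S}_i\in kA\text{ for some }i\in\{0,\dots,n-k\}\}.$$ Then, for every $t\in(0,1)$ and every $A\in\mathcal{B}(\mathbb{R}^d)$ bounded away from $\mathbf{0}$, $$\mu(A^\circ(t))\le\liminf_{n\to\infty}\frac{\mathrm{P}(n^{-1}R_n(A)>t)}{n\mathrm{P}(|\mathbf{Z}|>n)}\le\limsup_{n\to\infty}\frac{\mathrm{P}(n^{-1}R_n(A)>t)}{n\mathrm{P}(|\mathbf{Z}|>n)}\le\mu(A^*(t)),$$ where $$A^*(t)=\bigcup_{t\le s\le1}s\overline{A},\qquad A^\circ(t)=\bigcup_{t<s\le1}sA^\circ,$$ and $\overline{A}$, $A^\circ$ denote the closure and interior of $A$.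
   Context: $|\cdot|$ is the (Euclidean) norm on $\mathbb{R}^d$ and $\overline{\mathbb{R}}=\mathbb{R}\cup\{-\infty,\infty\}$. A set $A\subset\mathbb{R}^d$ is bounded away from $\mathbf{0}$ if $\mathbf{0}\notin\overline{A}$. In the definition of $R_n(A)$, $k$ ranges over $\{0,1,\dots,n\}$ and $\sup\varnothing=0$. Vague convergence. The space $\overline{\mathbb{R}}^d\setminus\{\mathbf{0}\}$ is topologized so that its Borel sets coincide with those of $\mathbb{R}^d$ on $\mathbb{R}^d\setminus\{\mathbf{0}\}$ and so that a Borel set $B$ is relatively compact iff $B\cap\mathbb{R}^d$ is bounded away from $\mathbf{0}$. Vague convergence $\mu_n\xrightarrow{v}\mu$ of Radon measures on it means $\mu_n(B)\to\mu(B)$ for every relatively compact Borel $B$ with $\mu(\partial B)=0$. Regular variation. $\mathbf{Z}\in\mathrm{RV}(\alpha,\mu)$ means: $\mu$ is a nonnull Radon measure on $\mathcal{B}(\overline{\mathbb{R}}^d\setminus\{\mathbf{0}\})$ with $\mu(\overline{\mathbb{R}}^d\setminus\mathbb{R}^d)=0$; there is a sequence $0<a_n\uparrow\infty$, chosen so that $n\mathrm{P}(|\mathbf{Z}|>a_n)\to1$, with $n\mathrm{P}(a_n^{-1}\mathbf{Z}\in\cdot)\xrightarrow{v}\mu(\cdot)$; and $\mu(uB)=u^{-\alpha}\mu(B)$ for all $u>0$ and Borel $B$. With this normalization, $\mathrm{P}(\mathbf{Z}\in u\,\cdot)/\mathrm{P}(|\mathbf{Z}|>u)\xrightarrow{v}\mu(\cdot)$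 as $u\to\infty$. *)

(* Defs.v *)
From HB Require Import structures.
From mathcomp Require Import all_boot all_order all_algebra.
From mathcomp Require Import all_classical all_reals all_analysis.
Set Implicit Arguments.
Unset Strict Implicit.
Unset Printing Implicit Defensive.
Import Order.TTheory GRing.Theory Num.Theory.
Import numFieldNormedType.Exports.
Local Open Scope classical_set_scope.
Local Open Scope ring_scope.

(* Vectors live in 'rV[R]_d.+1, so that the dimension d.+1 runs over all
   integers >= 1: the measurable types of the library are inhabited, whereas
   the punctured extended space below is empty in dimension 0. *)

Section spaces.
Context (R : realType) (d : nat).

Definition borel_rV := g_sigma_algebraType (@open 'rV[R]_d.+1).

(* The norm carried by 'rV[R]_d.+1 is the sup norm; the topology is the same. *)
Definition enorm (x : 'rV[R]_d.+1) : R := Num.sqrt (\sum_j x 0 j ^+ 2).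

Definition bounded_away (A : set 'rV[R]_d.+1) : Prop := ~ closure A 0.

Definition ext_rV0 : Type :=
  set_type ([set~ const_mx 0%E] : set 'rV[\bar R]_d.+1).

HB.instance Definition _ := Topological.on ext_rV0.

Fact const_pinfty_neq0 :
  (const_mx +oo%E : 'rV[\bar R]_d.+1) \in [set~ const_mx 0%E].
Proof. by rewrite inE /= => /rowP /(_ ord0); rewrite !mxE. Qed.

HB.instance Definition _ :=
  isPointed.Build ext_rV0 (exist _ (const_mx +oo%E) const_pinfty_neq0).

Definition borel_ext := g_sigma_algebraType (@open ext_rV0).

(* R^d \ {0} sits in the punctured extended space: to_ext A is A \ {0} seen
   there, and finite_part B is the trace of B on R^d. *)
Definition to_ext (A : set 'rV[R]_d.+1) : set ext_rV0 :=
  [set x | exists2 y, A y & set_val x = map_mx EFin y].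

Definition finite_part (B : set ext_rV0) : set 'rV[R]_d.+1 :=
  [set y | exists2 x, B x & set_val x = map_mx EFin y].

Definition scale_ext (u : R) (B : set ext_rV0) : set ext_rV0 :=
  [set x | exists2 y, B y & set_val x = map_mx (fun z => (u%:E * z)%E) (set_val y)].

Definition radon (mu : {measure set borel_ext -> \bar R}) : Prop :=
  forall B : set ext_rV0, measurable (B : set borel_ext) -> precompact B ->
    (mu B < +oo)%E.

Definition boundary (B : set ext_rV0) : set ext_rV0 := closure B `\` B°.

Definition vague_cvg (mu_ : nat -> set ext_rV0 -> \bar R)
    (mu : {measure set borel_ext -> \bar R}) : Prop :=
  forall B : set ext_rV0, measurable (B : set borel_ext) -> precompact B ->
    mu (boundary B) = 0%E -> mu_ n B @[n --> \oo] --> mu B.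

End spaces.

Section probability.
Context {dO : measure_display} {Omega : measurableType dO} {R : realType}.
Variable P : probability Omega R.

Definition mutually_independent {d' : measure_display} {T : measurableType d'}
    (X : nat -> {RV P >-> T}) : Prop :=
  forall (J : seq nat) (B : nat -> set T), uniq J ->
    (forall i, measurable (B i)) ->
    P (\bigcap_(i in [set` J]) X i @^-1` B i) =
      (\prod_(i <- J) fine (P (X i @^-1` B i)))%:E.

Definition identically_distributed {d' : measure_display}
    {T : measurableType d'} (X : nat -> {RV P >-> T}) : Prop :=
  forall (i j : nat) (B : set T), measurable B ->
    P (X i @^-1` B) = P (X j @^-1` B).

Definition norm_tail (d : nat) (Z : {RV P >-> borel_rV R d}) (u : R) : \bar R :=
  P [set w | u < enorm (Z w)].

Definition regularly_varying (d : nat) (Z : {RV P >-> borel_rV R d})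
    (alpha : R) (mu : {measure set borel_ext R d -> \bar R}) : Prop :=
  [/\ mu setT != 0%E,
      radon mu,
      mu (~` to_ext setT) = 0%E,
      exists a : nat -> R,
        [/\ (forall n, 0 < a n), {homo a : m n / (m <= n)%N >-> m <= n},
            a n @[n --> \oo] --> +oo,
            (n%:R%:E * norm_tail Z (a n))%E @[n --> \oo] --> 1%E &
            vague_cvg (fun n B => n%:R%:E *
              P [set w | finite_part B ((a n)^-1 *: (Z w : 'rV[R]_d.+1))])%E mu] &
      forall (u : R) (B : set (borel_ext R d)), 0 < u -> measurable B ->
        mu (scale_ext u B) = ((u `^ (- alpha))%:E * mu B)%E].

(* In a sequence (Z_i), the term Z_0 is the generic vector written without index
   on paper: it is left out of S_m = Z_1 + ... + Z_m. *)
Definition walk (d : nat) (Z : nat -> {RV P >-> borel_rV R d}) (m : nat)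
    (w : Omega) : 'rV[R]_d.+1 :=
  \sum_(1 <= i < m.+1) (Z i w : 'rV[R]_d.+1).

Definition longest_stretch (d : nat) (Z : nat -> {RV P >-> borel_rV R d})
    (A : set 'rV[R]_d.+1) (n : nat) (w : Omega) : nat :=
  \max_(k < n.+1 | `[< exists2 i, (i <= n - k)%N &
      [set k%:R *: x | x in A] (walk Z (i + k) w - walk Z i w) >]) k.

Definition stretch_ratio (d : nat) (Z : nat -> {RV P >-> borel_rV R d})
    (A : set 'rV[R]_d.+1) (t : R) (n : nat) : \bar R :=
  (fine (P [set w | (t < n%:R^-1 * (longest_stretch Z A n w)%:R)%R])
     / (n%:R * fine (norm_tail (Z 0%N) n%:R)))%:E.

End probability.

Definition star_set (R : realType) (d : nat) (A : set 'rV[R]_d.+1) (t : R) :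
  set 'rV[R]_d.+1 :=
  \bigcup_(s in [set s : R | t <= s <= 1]) [set s *: x | x in closure A].

Definition circ_set (R : realType) (d : nat) (A : set 'rV[R]_d.+1) (t : R) :
  set 'rV[R]_d.+1 :=
  \bigcup_(s in [set s : R | t < s <= 1]) [set s *: x | x in A°].

(* Main.v *)
Require Import Defs.
From HB Require Import structures.
From mathcomp Require Import all_boot all_order all_algebra.
From mathcomp Require Import finmap.
From mathcomp Require Import all_classical all_reals all_analysis.
From mathcomp Require Import measurable_realfun ring lra zify.
Set Implicit Arguments.
Unset Strict Implicit.
Unset Printing Implicit Defensive.
Import Order.TTheory GRing.Theory Num.Theory.
Import numFieldNormedType.Exports.
Local Open Scope classical_set_scope.
Local Open Scope ring_scope.

(* One big jump. Fix small eta and choose L, eps and a truncation level u = u_n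
   with u_n = o(n). Call bad the event that, among Z_1, ..., Z_n, two jumps exceed
   eps n, or L jumps exceed u, or some block of consecutive terms truncated at u
   has a coordinate sum above eta n / 2. Regular variation bounds the first two
   by (n P(|Z| > eps n))^2 and (n P(|Z| > u))^L, a Chernoff bound with E Z = 0
   bounds the third, and u can be chosen so that all are o(n P(|Z| > n)). Off the
   bad event every block sum is within eta n of its jump larger than eps n, if
   any, so up to eta the event R_n(A) > t n says that some Z_l / n lies in
   the union of the (k/n) A, t < k/n <= 1. The union bound (resp. Bonferroni's
   inequality) and the portmanteau bounds P(Z / n in F) <~ mu(F) P(|Z| > n) for F
   closed (resp. >~ for open sets) conclude, letting eta tend to 0. *)

(** * The punctured extended space *)

(** The Chernoff exponent used here is of order n/u, so truncation at u = eps n would leave a bound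
    that does not vanish, whereas o(n P(|Z| > n)) asks for more than a power of n. This forces a
    level u = o(n), and with it a third kind of term, between u and eps n; bounding their number by
    L costs (n P(|Z| > u))^L. As alpha > 1, n P(|Z| > n) tends to 0, which makes its square
    negligible; as alpha <= 2 is allowed, the Chernoff bound has to work with a first moment only.
    The choice of u rests on comparing P(|Z| > 2n) with P(|Z| > n), in place of Potter's bounds.

    Two restrictions of the definition of regular variation have to be lifted. It speaks of the
    scales a_m only: an integer n is placed between a_m and a_{m+1}, whose ratio tends to 1. It
    speaks of sets with null boundary only: a closed set is enlarged to a sublevel set of its
    distance function, and the bound for open sets follows by taking complements outside a ball. *)

Lemma ereal_compact (R : realType) : compact [set: \bar R].
Proof.
move=> F FF _; apply: contrapT => nocl.
have notcl (p : \bar R) : exists A B, [/\ F A, nbhs p B & A `&` B = set0].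
  apply: contrapT => h; apply: nocl; exists p; split => // A B FA pB.
  by apply/set0P/negP => /eqP AB; apply: h; exists A, B.
(* Without cluster points, [F] misses a neighbourhood of each infinity, so it lives on the image of
   a real segment, which is compact. *)
have [A [U [FA [M [_ MU]] AU]]] := notcl +oo%E.
have [B [W [FB [m [_ mW]] BW]]] := notcl -oo%E.
have : compact (EFin @` `[m, M]).
  apply: continuous_compact; last exact: segment_compact.
  by apply: continuous_subspaceT => x; apply: cvg_EFin; [exact: nearW|exact: cvg_id].
move=> /(_ F FF) [].
  apply: filterS (filterI FA FB) => x [Ax Bx].
  have xM : (x <= M%:E)%E.
    by rewrite leNgt; apply/negP => /MU Ux; have : set0 x by rewrite -AU.
  have mx : (m%:E <= x)%E.
    by rewrite leNgt; apply/negP => /mW Ux; have : set0 x by rewrite -BW.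
  case: x mx xM {Ax Bx} => [x||]; rewrite ?lee_fin// => mx xM.
  by exists x => //=; rewrite in_itv/= mx xM.
by move=> p [_ pF]; apply: nocl; exists p.
Qed.

Section ext_topology.
Context (R : realType) (d : nat).
Local Notation V := 'rV[R]_d.+1.
Implicit Types (A B : set V) (x : ext_rV0 R d) (y : V).

Lemma map_EFin_inj : injective (map_mx EFin : V -> 'rV[\bar R]_d.+1).
Proof. by move=> x y /rowP h; apply/rowP => j; have := h j; rewrite !mxE => -[]. Qed.

Lemma to_ext_ex y : y != 0 -> exists x, set_val x = map_mx EFin y.
Proof.
move=> y0; have : map_mx EFin y \in [set~ const_mx 0%E].
  rewrite inE /= => h; move: y0; apply/negP; rewrite negbK; apply/eqP.
  by apply: map_EFin_inj; rewrite h; apply/rowP => j; rewrite !mxE.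
by move=> h; exists (SigSub h).
Qed.

Lemma to_ext_val x y : set_val x = map_mx EFin y -> y != 0.
Proof.
move=> xy; apply/eqP => y0; have /set_mem /= := valP x; apply.
have -> : val x = map_mx EFin y by rewrite -xy.
by rewrite y0; apply/rowP => j; rewrite !mxE.
Qed.

Lemma to_extS A B : A `<=` B -> to_ext A `<=` to_ext B.
Proof. by move=> AB x [y Ay xy]; exists y => //; exact: AB. Qed.

Lemma to_ext_bigcup (F : nat -> set V) :
  to_ext (\bigcup_n F n) = \bigcup_n to_ext (F n).
Proof.
apply/seteqP; split => x; first by move=> [y [n _ Fy] xy]; exists n => //; exists y.
by move=> [n _ [y Fy xy]]; exists y => //; exists n.
Qed.

Lemma to_ext_bigcap (F : nat -> set V) :
  to_ext (\bigcap_n F n) = \bigcap_n to_ext (F n).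
Proof.
apply/seteqP; split => x; first by move=> [y Fy xy] n _; exists y => //; exact: Fy.
move=> h; have [y _ xy] := h 0%N I; exists y => // n _.
by have [z Fz xz] := h n I; rewrite (_ : y = z)//; apply: map_EFin_inj; rewrite -xy.
Qed.

Lemma to_extU A B : to_ext (A `|` B) = to_ext A `|` to_ext B.
Proof.
apply/seteqP; split => x.
  by move=> [y [Ay|By] xy]; [left|right]; exists y.
by move=> [[y Ay xy]|[y By xy]]; exists y => //; [left|right].
Qed.

Lemma to_extI A B : to_ext (A `&` B) = to_ext A `&` to_ext B.
Proof.
apply/seteqP; split => x; first by move=> [y [Ay By] xy]; split; exists y.
move=> [[y Ay xy] [z Bz xz]]; exists y => //; split => //.
by rewrite (_ : y = z)//; apply: map_EFin_inj; rewrite -xy.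
Qed.

Lemma to_extD A B : to_ext (A `\` B) = to_ext A `\` to_ext B.
Proof.
apply/seteqP; split => x.
  move=> [y [Ay nBy] xy]; split; first by exists y.
  move=> [z Bz xz]; apply: nBy.
  by rewrite (_ : y = z)//; apply: map_EFin_inj; rewrite -xy.
move=> [[y Ay xy] h]; exists y => //; split => // By.
by apply: h; exists y.
Qed.

Lemma finite_part_to_ext A : ~ A 0 -> finite_part (to_ext A) = A.
Proof.
move=> A0; apply/seteqP; split => y.
  move=> [x [z Az xz] xy]; rewrite (_ : y = z)//.
  by apply: map_EFin_inj; rewrite -xy.
move=> Ay; have y0 : y != 0 by apply/eqP => y0; rewrite y0 in Ay.
by have [x xy] := to_ext_ex y0; exists x => //; exists y.
Qed.

Lemma open_to_ext A : open A -> open (to_ext A).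
Proof.
move=> oA; exists [set M | exists2 y, A y & M = map_mx EFin y]; last first.
  by apply/seteqP; split => x.
rewrite openE => _ [y Ay ->]; have /nbhs_ballP[e /= e0 eA] : nbhs y A.
  exact: open_nbhs_nbhs.
(* These neighbourhoods contain finite values only, so every extended vector in them comes from the
   real vector of its [fine] parts. *)
exists (fun i j => EFin @` ball (y i j) e).
  move=> i j; rewrite mxE /nbhs /= /ereal_nbhs.
  by apply: filterS (nbhsx_ballx (y i j) e e0) => z /= zb; exists z.
move=> M /= hM.
exists (\row_j fine (M 0 j)).
  apply: eA; split => // i j; have [z yz zM] := hM i j.
  by move: zM yz; rewrite mxE (ord1 i) => <-.
by apply/rowP => j; rewrite !mxE; have [z yz <-] := hM 0 j.
Qed.

Lemma measurable_to_ext_open A : open A -> measurable (to_ext A : set (borel_ext R d)).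
Proof. by move=> oA; apply: sub_sigma_algebra; exact: open_to_ext. Qed.

Lemma to_extT_setC A : to_ext A = to_ext setT `\` to_ext (~` A).
Proof. by rewrite -to_extD setTD setCK. Qed.

Lemma measurable_to_ext_closed A :
  closed A -> measurable (to_ext A : set (borel_ext R d)).
Proof.
move=> cA; rewrite to_extT_setC; apply: measurableD.
  by apply: measurable_to_ext_open; exact: openT.
by apply: measurable_to_ext_open; exact: closed_openC.
Qed.

Lemma closure_to_ext A : closed A -> closure (to_ext A) `<=` to_ext A `|` ~` to_ext setT.
Proof.
move=> cA; have -> : to_ext A `|` ~` to_ext setT = ~` to_ext (~` A).
  by rewrite (to_extT_setC (~` A)) setCK setCD setUC.
have oAC : open (to_ext (~` A)) by apply: open_to_ext; exact: closed_openC.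
have cAC : closed (~` to_ext (~` A) : set (ext_rV0 R d)) by exact: open_closedC.
rewrite [X in _ `<=` X]((closure_id _).1 cAC).
by apply: closure_subset => x xA; rewrite to_extT_setC in xA; case: xA.
Qed.

Lemma bounded_away_ball A : bounded_away A ->
  exists2 e, 0 < e & forall y, A y -> e <= `|y|.
Proof.
move=> A0; have /nbhs_ballP[e /= e0 eA] : nbhs (0 : V) (~` closure A).
  by apply: open_nbhs_nbhs; split => //; apply: closed_openC; exact: closed_closure.
exists e => // y Ay; rewrite leNgt; apply/negP => ye; apply: (eA y).
  by rewrite -ball_normE /= sub0r normrN.
exact: subset_closure.
Qed.

Lemma ball_bounded_away A e : 0 < e -> (forall y, A y -> e <= `|y|) -> bounded_away A.
Proof.
move=> e0 eA /(_ (ball 0 e)) []; first exact: nbhsx_ballx.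
by move=> y [/eA ye]; rewrite -ball_normE /= sub0r normrN ltNge ye.
Qed.

(** A power of the extended line is compact, and a cluster point of a filter that avoids the open
    cube [U] around the origin stays outside [U], hence in the punctured space. *)
Lemma precompact_to_ext A : bounded_away A -> precompact (to_ext A).
Proof.
move=> /bounded_away_ball[e e0 eA].
pose U := [set M : 'rV[\bar R]_d.+1 | forall i j, (`|M i j| < e%:E)%E].
pose K := ~` (set_val @^-1` U) : set (ext_rV0 R d).
have oU : open U.
  rewrite openE => M UM; exists (fun i j => [set z | (`|z| < e%:E)%E]) => //= i j.
  have -> : [set z : \bar R | (`|z| < e%:E)%E] =
      [set z | (- e%:E < z)%E] `&` [set z | (z < e%:E)%E].
    by apply/seteqP; split => z /=; rewrite lte_absl => /andP.
  apply: open_nbhs_nbhs; split; last by have := UM i j; rewrite lte_absl => /andP.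
  apply: openI; [exact: open_ereal_gt_ereal|exact: open_ereal_lt_ereal].
have cK : closed K by apply: open_closedC; exists U.
apply: (@precompact_subset _ _ K).
  move=> x [y Ay xy] /= Ux; have := eA _ Ay; apply/negP; rewrite -ltNge.
  rewrite [ltLHS]/Num.norm /= mx_normrE; apply/bigmax_ltP; split => // -[i j] _ /=.
  by have := Ux i j; rewrite xy mxE.
rewrite precompact_closed// => F FF FK.
have : compact [set v : 'rV[\bar R]_d.+1 | forall i, [set: \bar R] (v ord0 i)].
  by apply: (@rV_compact (\bar R) d.+1 (fun=> setT)) => i; exact: ereal_compact.
move=> /(_ (set_val @ F)) [].
  by apply: filterS filterT.
move=> p [_ clp].
have p0 : ~ U p.
  move=> Up; have pU : nbhs p U by exact: open_nbhs_nbhs.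
  have FK' : (set_val @ F) (set_val @` K) by apply: (@filterS _ F _ K) => // x Kx; exists x.
  by have [_ [[y ? <-]]] := clp _ _ FK' pU.
have : p \in [set~ const_mx 0%E].
  by rewrite inE /= => p00; apply: p0 => i j; rewrite p00 mxE abse0 lte_fin.
move=> p1; exists (SigSub p1); split; first by rewrite /K /=.
move=> A' B' FA'; rewrite nbhsE => -[_ [[W oW <-] /= Wp] WB].
have pW : nbhs p W by exact: open_nbhs_nbhs.
have FA'' : (set_val @ F) (set_val @` A') by apply: (@filterS _ F _ A') => // x A'x; exists x.
have [_ [[x A'x <-] Wx]] := clp _ _ FA'' pW.
by exists x; split => //; exact: WB.
Qed.

End ext_topology.

(** * Limit measure: uncharged level sets and monotone limits *)

Section level_sets.
Context {disp : measure_display} {T : measurableType disp} {R : realType}.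
Variable m : {measure set T -> \bar R}.
Local Open Scope ereal_scope.

(** For each k only finitely many of these disjoint sets have mass above 1/(k+1), since (k+1) m(U)
    of them or more would outweigh [U]. *)
Lemma countable_charged (D : R -> set T) (U : set T) :
  (forall r, measurable (D r)) -> measurable U -> m U < +oo ->
  trivIset [set: R] D -> (forall r, 0 < m (D r) -> D r `<=` U) ->
  countable [set r | 0 < m (D r)].
Proof.
move=> mD mU Uoo tD DU.
pose S k := [set r | k.+1%:R^-1%:E < m (D r)].
have finS k : finite_set (S k).
  apply: contrapT => infS.
  have [X XS NX] := infinite_set_fset (k.+1 * Num.bound (fine (m U)))%N infS.
  have XU r : [set` X] r -> D r `<=` U.
    by move=> /XS rX; apply: DU; apply: le_lt_trans rX; rewrite lee_fin.
  have sumU : \sum_(r <- X) m (D r) <= m U.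
    rewrite -measure_fbigsetU//; last exact: sub_trivIset tD.
    apply: le_measure; rewrite ?inE//; first exact: bigsetU_measurable.
    by rewrite -bigcup_fset; exact: bigcup_sub.
  suff /lt_le_trans/(_ sumU) : m U < \sum_(r <- X) m (D r) by rewrite ltxx.
  apply: (@lt_le_trans _ _ (\sum_(r <- X) k.+1%:R^-1%:E)); last first.
    by rewrite !big_seq; apply: lee_sum => r /XS /ltW.
  rewrite sumEFin big_const_seq count_predT iter_addr_0 -[ltLHS]fineK ?ge0_fin_numE//.
  rewrite lte_fin -[ltRHS]mulr_natl ltr_pdivlMr//.
  apply: lt_le_trans (_ : (k.+1 * Num.bound (fine (m U)))%:R <= _)%R; last by rewrite ler_nat.
  by rewrite natrM mulrC ltr_pM2l// archi_boundP// fine_ge0.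
apply: (@sub_countable _ _ _ (\bigcup_k S k)).
  apply: subset_card_le => r /= Dr.
  have fD : m (D r) \is a fin_num.
    by rewrite ge0_fin_numE//; apply: le_lt_trans Uoo; apply: le_measure; rewrite ?inE//; exact: DU.
  have /ltr_add_invr[k] : (0 < fine (m (D r)))%R by rewrite fine_gt0// Dr -ge0_fin_numE.
  by rewrite add0r => kr; exists k => //; rewrite /S /= -[ltRHS]fineK// lte_fin.
by apply: bigcup_countable => // k _; exact: finite_set_countable.
Qed.
(** The charged parameters are countable, whereas the interval ]0, r0[ has positive Lebesgue
    measure. Emptying [D r] for the other [r] puts the whole family inside [U]. *)
Lemma exists_uncharged (D : R -> set T) (U : set T) (r0 : R) :
  (forall r, measurable (D r)) -> measurable U -> m U < +oo ->
  trivIset [set: R] D -> (forall r, (0 < r < r0)%R -> D r `<=` U) -> (0 < r0)%R ->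
  exists2 r, (0 < r < r0)%R & m (D r) = 0.
Proof.
move=> mD mU Uoo tD DU r0_gt0.
pose D' r := if (0 < r < r0)%R then D r else set0.
have mD' r : measurable (D' r) by rewrite /D'; case: ifP.
have D'U r : D' r `<=` U by rewrite /D'; case: ifPn => [rr|_]; [exact: DU|exact: sub0set].
have tD' : trivIset [set: R] D'.
  apply/trivIsetP => i j _ _ ij; rewrite /D'; case: ifP => _; last by rewrite set0I.
  by case: ifP => _; rewrite ?setI0//; move/trivIsetP : tD; exact.
have cD' := countable_charged mD' mU Uoo tD' (fun r _ => D'U r).
apply: contrapT => h.
have : countable `]0%R, r0[%classic.
  apply: sub_countable cD'; apply: subset_card_le => r /=.
  rewrite in_itv /= => rr; rewrite /D' rr lt0e measure_ge0 andbT.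
  by apply/eqP => Dr0; apply: h; exists r.
move=> /countable_lebesgue_measure0; rewrite lebesgue_measure_itv /= lte_fin r0_gt0.
by rewrite sube0 => -[] r00; rewrite r00 ltxx in r0_gt0.
Qed.

End level_sets.

Section vague.
Context (R : realType) (d : nat).
Local Notation V := 'rV[R]_d.+1.
Variable mu : {measure set borel_ext R d -> \bar R}.
Hypothesis radon_mu : radon mu.
Hypothesis mu_oo : mu (~` to_ext setT) = 0%E.
Implicit Types (A B F G : set V).

(** Meant for sets bounded away from the origin, whose mass is finite because [mu] is Radon; an
    infinite mass would be read as 0. *)
Definition fmass A : R := fine (mu (to_ext A)).

Lemma bounded_awayS A B : A `<=` B -> bounded_away B -> bounded_away A.
Proof. by move=> AB + A0; apply; exact: closure_subset A0. Qed.

Lemma bounded_away_closure A : bounded_away A -> bounded_away (closure A).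
Proof. by rewrite /bounded_away -((closure_id _).1 (@closed_closure _ A)). Qed.

Lemma mu_to_ext_fin_closed F : closed F -> bounded_away F -> mu (to_ext F) \is a fin_num.
Proof.
move=> cF F0; rewrite ge0_fin_numE//; apply: radon_mu.
  exact: measurable_to_ext_closed.
exact: precompact_to_ext.
Qed.

Lemma mu_to_ext_fin A : measurable (to_ext A : set (borel_ext R d)) ->
  bounded_away A -> mu (to_ext A) \is a fin_num.
Proof.
move=> mA A0; rewrite ge0_fin_numE//.
apply: (@le_lt_trans _ _ (mu (to_ext (closure A)))).
  apply: le_measure; rewrite ?inE//.
    by apply: measurable_to_ext_closed; exact: closed_closure.
  by apply: to_extS; exact: subset_closure.
rewrite -ge0_fin_numE//; apply: mu_to_ext_fin_closed; first exact: closed_closure.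
exact: bounded_away_closure.
Qed.

Lemma fmassE A : measurable (to_ext A : set (borel_ext R d)) ->
  bounded_away A -> (fmass A)%:E = mu (to_ext A).
Proof. by move=> mA A0; rewrite fineK// mu_to_ext_fin. Qed.

Lemma fmass_ge0 A : 0 <= fmass A.
Proof. exact: fine_ge0. Qed.

Lemma le_fmass A B : measurable (to_ext A : set (borel_ext R d)) ->
  measurable (to_ext B : set (borel_ext R d)) -> bounded_away B -> A `<=` B ->
  fmass A <= fmass B.
Proof.
move=> mA mB B0 AB; rewrite -lee_fin !fmassE//; last exact: bounded_awayS B0.
by apply: le_measure; rewrite ?inE//; exact: to_extS.
Qed.

Lemma fmass_bigcap (F : nat -> set V) (e : R) : (forall n, closed (F n)) ->
  {homo F : n m / (n <= m)%N >-> m `<=` n} -> bounded_away (F 0%N) -> 0 < e ->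
  exists n, fmass (F n) <= fmass (\bigcap_n F n) + e.
Proof.
move=> cF niF F0 e0.
have Fn0 n : bounded_away (F n) by apply: bounded_awayS F0; exact: niF.
have cI : closed (\bigcap_n F n) by exact: closed_bigI.
have mF n : measurable (to_ext (F n) : set (borel_ext R d)).
  exact: measurable_to_ext_closed.
have mI : measurable (to_ext (\bigcap_n F n) : set (borel_ext R d)).
  exact: measurable_to_ext_closed.
have I0 : bounded_away (\bigcap_n F n) by apply: bounded_awayS F0 => x; exact.
have : (mu \o (@to_ext R d \o F)) x @[x --> \oo] --> mu (\bigcap_n to_ext (F n)).
  apply: nonincreasing_cvg_mu => //=.
  - by rewrite -ge0_fin_numE// mu_to_ext_fin.
  - by rewrite -to_ext_bigcap.
  - by move=> n m nm; apply/subsetPset/to_extS/niF.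
rewrite -to_ext_bigcap -fmassE//.
have -> : mu \o (@to_ext R d \o F) = EFin \o (fmass \o F).
  by apply/funext => n /=; rewrite fmassE.
move=> /fine_cvg /= h.
have [|N _ hN] := cvgr_lt _ h (fmass (\bigcap_n F n) + e); first by rewrite ltrDl.
by exists N; apply/ltW/hN => /=.
Qed.

Lemma fmass_bigcup (G : nat -> set V) (e : R) : (forall n, open (G n)) ->
  {homo G : n m / (n <= m)%N >-> n `<=` m} -> bounded_away (\bigcup_n G n) -> 0 < e ->
  exists n, fmass (\bigcup_n G n) - e <= fmass (G n).
Proof.
move=> oG ndG U0 e0.
have Gn0 n : bounded_away (G n) by apply: bounded_awayS U0; exact: bigcup_sup.
have oU : open (\bigcup_n G n) by exact: bigcup_open.
have mG n : measurable (to_ext (G n) : set (borel_ext R d)).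
  exact: measurable_to_ext_open.
have mU : measurable (to_ext (\bigcup_n G n) : set (borel_ext R d)).
  exact: measurable_to_ext_open.
have : (mu \o (@to_ext R d \o G)) x @[x --> \oo] --> mu (\bigcup_n to_ext (G n)).
  apply: nondecreasing_cvg_mu => //=.
  - by rewrite -to_ext_bigcup.
  - by move=> n m nm; apply/subsetPset/to_extS/ndG.
rewrite -to_ext_bigcup -fmassE//.
have -> : mu \o (@to_ext R d \o G) = EFin \o (fmass \o G).
  by apply/funext => n /=; rewrite fmassE.
move=> /fine_cvg /= h.
have [|N _ hN] := cvgr_gt _ h (fmass (\bigcup_n G n) - e).
  by rewrite ltrBlDr ltrDl.
by exists N; apply/ltW/hN => /=.
Qed.

(** The boundary in the extended space is contained in [F] minus [G] together with points at
    infinity, and [mu_oo] makes the latter null. *)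
Lemma boundary_to_ext F G B : closed F -> open G -> G `<=` B -> B `<=` F ->
  mu (to_ext (F `\` G)) = 0%E -> mu (boundary (to_ext B)) = 0%E.
Proof.
move=> cF oG GB BF FG0.
have cFG : closed (F `\` G) by apply: closedI => //; exact: open_closedC.
have mb : measurable (boundary (to_ext B) : set (borel_ext R d)).
  apply: measurableD.
    rewrite -[X in measurable X]setCK; apply: measurableC; apply: sub_sigma_algebra.
    by apply: closed_openC; exact: closed_closure.
  by apply: sub_sigma_algebra; exact: open_interior.
apply/eqP; rewrite eq_le measure_ge0 andbT.
have mT : measurable (~` to_ext setT : set (borel_ext R d)).
  by apply: measurableC; apply: measurable_to_ext_open; exact: openT.
have mD : measurable (to_ext (F `\` G) : set (borel_ext R d)).
  exact: measurable_to_ext_closed.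
apply: (@le_trans _ _ (mu (to_ext (F `\` G) `|` ~` to_ext setT))).
  apply: le_measure; rewrite ?inE//; first exact: measurableU.
  move=> x [/(closure_subset (to_extS BF))/(closure_to_ext cF)[Fx|Tx]]; last by right.
  move=> Ix; left; rewrite to_extD; split => //; apply: contra_not Ix => Gx.
  apply: (filterS (to_extS GB)); apply: open_nbhs_nbhs.
  by split => //; exact: open_to_ext.
apply: (le_trans (measureU2 _ _ _)) => //.
by rewrite -[leRHS]adde0; apply: leeD; rewrite le_eqVlt; apply/orP; left; apply/eqP.
Qed.

(* The level sets {dist(., F) = r} are disjoint, so all but countably many of
   them are mu-null. *)
Lemma closed_nbhd F (e : R) : closed F -> bounded_away F -> 0 < e ->
  exists F' r, [/\ 0 < r, closed F' /\ bounded_away F',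
    (forall x y, F y -> `|x - y| < r -> F' x),
    fmass F' <= fmass F + e & mu (boundary (to_ext F')) = 0%E].
Proof.
move=> cF /bounded_away_ball[dl dl0 Fdl] e0.
pose g := @edist_inf R V F.
have cg : continuous g by exact: edist_inf_continuous.
pose K r := [set x | (g x <= r%:E)%E].
have cK r : closed (K r).
  by apply: (@closed_comp _ _ g [set x | (x <= r%:E)%E]) => //; exact: closed_ereal_ge_ereal.
pose O r := [set x | (g x < r%:E)%E].
have oO r : open (O r).
  by apply: (@open_comp _ _ g [set x | (x < r%:E)%E]) => //; exact: open_ereal_lt_ereal.
have K0 r : r <= dl / 3 -> bounded_away (K r).
  move=> rdl; apply: (@ball_bounded_away _ _ _ (dl / 2)); first lra.
  move=> y; rewrite /K /= => gy.
  have : (g y < (dl / 2)%:E)%E by apply: le_lt_trans gy _; rewrite lte_fin; lra.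
  move=> /ereal_inf_ltP[_ [a Fa <-]] /edist_lt_ball /=.
  rewrite -ball_normE /= => ya; have := Fdl _ Fa.
  have := ler_normD y (a - y); rewrite addrCA subrr addr0 distrC; lra.
(* Radii of at most dl / 3 keep all the sets [K (c n)] at distance dl / 2 from the origin; they
   shrink to [F] because [F] is closed. *)
pose c n := dl / 3 / n.+1%:R.
have c0 n : 0 < c n by rewrite divr_gt0//; lra.
have cle n : c n <= dl / 3.
  by rewrite ler_pdivrMr// ler_peMr//; [lra|rewrite ler1n].
have capK : \bigcap_n K (c n) = F.
  apply/seteqP; split => x; last first.
    by move=> Fx n _; rewrite /K /= /g edist_inf0// lee_fin ltW.
  move=> Kx; rewrite (closure_id F).1//; move=> B /nbhs_ballP[r /= r0 rB].
  have [n cn] : exists n, c n < r.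
    have [n ndl] := ltr_add_invr (divr_gt0 r0 dl0).
    exists n; rewrite /c; move: ndl; rewrite add0r ltr_pdivlMr// => ndl.
    apply: le_lt_trans ndl; rewrite mulrC ler_wpM2l ?invr_ge0//; lra.
  have : (g x < r%:E)%E by apply: le_lt_trans (Kx n I) _; rewrite lte_fin.
  move=> /ereal_inf_ltP[_ [a Fa <-]] /edist_lt_ball /= ra.
  by exists a; split => //; exact: rB.
have [|n hn] := @fmass_bigcap (K \o c) e (fun n => cK _) _ (K0 _ (cle 0%N)) e0.
  move=> n m nm x /= /le_trans; apply; rewrite lee_fin /c.
  by rewrite ler_pM2l ?lef_pV2 ?posrE ?ler_nat//; lra.
pose D r := to_ext (K r `\` O r) : set (borel_ext R d).
have cD r : closed (K r `\` O r) by apply: closedI => //; exact: open_closedC.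
have [||||||r /andP[r0 rc] Dr0] := @exists_uncharged _ _ _ mu D (to_ext (K (c n))) (c n).
- by move=> r; exact: measurable_to_ext_closed.
- exact: measurable_to_ext_closed.
- by rewrite -ge0_fin_numE// mu_to_ext_fin_closed//; exact: K0.
- apply/trivIsetP => i j _ _ ij; rewrite /D -to_extI; apply/seteqP; split => // x [y].
  move=> [[+ /negP+] [+ /negP+]] _; rewrite -!leNgt => h1 h2 h3 h4.
  have : (i%:E == j%:E)%E.
    by rewrite eq_le (le_trans h2 h3) (le_trans h4 h1).
  by rewrite eqe (negbTE ij).
- move=> r /andP[r0 rc]; apply: to_extS => x [/= gx _]; apply: (le_trans gx).
  by rewrite lee_fin ltW.
- by [].
exists (K r), r; split => //.
- by split => //; apply: K0; exact: le_trans (ltW rc) (cle n).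
- move=> x y Fy xy; rewrite /K /=; apply: (le_trans (@edist_inf_triangle R V F x y)).
  rewrite edist_inf0// adde0; apply: edist_fin => //=.
  by rewrite -ball_normE.
- move: hn; rewrite /= capK => /(le_trans _); apply; apply: le_fmass => //.
  + exact: measurable_to_ext_closed.
  + exact: measurable_to_ext_closed.
  + exact: K0.
  + by move=> x /le_trans; apply; rewrite lee_fin ltW.
- by apply: (@boundary_to_ext (K r) (O r)) => //; move=> x /ltW.
Qed.

End vague.

(** * Borel sets and the Euclidean norm *)

Section borel_rV_theory.
Context (R : realType) (d : nat).
Local Notation V := 'rV[R]_d.+1.
Implicit Types (A B F G : set V) (x y : V).

Lemma measurable_open_rV G : open G -> measurable (G : set (borel_rV R d)).
Proof. exact: sub_sigma_algebra. Qed.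

Lemma measurable_closed_rV F : closed F -> measurable (F : set (borel_rV R d)).
Proof.
move=> cF; rewrite -[F]setCK; apply: measurableC; apply: measurable_open_rV.
exact: closed_openC.
Qed.

Lemma continuous_rV_measurable_realfun (f : V -> R) : continuous f ->
  measurable_fun setT (f : borel_rV R d -> R).
Proof.
move=> cf; apply: (measurability _ (measurable_realfun.RGenOpens.measurableE R)).
move=> _ [_ [a [b ->] <-]]; rewrite setTI; apply: measurable_open_rV.
by apply: open_comp => // ? _; exact: cf.
Qed.

Lemma continuous_rV_measurable_fun (f : V -> V) : continuous f ->
  measurable_fun setT (f : borel_rV R d -> borel_rV R d).
Proof.
move=> cf; apply: (@measurability _ _ (borel_rV R d) (borel_rV R d) setT f (@open V)) => // _ [B oB <-].
rewrite setTI; apply: measurable_open_rV.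
by apply: open_comp => // ? _; exact: cf.
Qed.

Lemma continuous_enorm : continuous (@enorm R d).
Proof.
move=> x; apply: (@continuous_comp _ _ _ (fun x : V => \sum_j x 0 j ^+ 2)); last first.
  exact: sqrt_continuous.
apply: (cvg_big _ (nbhs_filter x)) => [|j _]; first exact: add_continuous.
exact: (@continuous_comp _ _ _ (fun M : V => M 0 j) (fun r => r ^+ 2) x
  (@coord_continuous _ _ _ _ _ x) (@exprn_continuous _ 2 _)).
Qed.

Lemma enormZ (c : R) x : enorm (c *: x) = `|c| * enorm x.
Proof.
rewrite /enorm -sqrtr_sqr -sqrtrM ?sqr_ge0//; congr Num.sqrt.
by rewrite mulr_sumr; apply: eq_bigr => j _; rewrite mxE exprMn.
Qed.

Lemma enorm_ge0 x : 0 <= enorm x. Proof. exact: sqrtr_ge0. Qed.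

Lemma coord_le_enorm x j : `|x 0 j| <= enorm x.
Proof.
rewrite -sqrtr_sqr /enorm ler_wsqrtr// (bigD1 j)//= lerDl.
by apply: sumr_ge0 => i _; exact: sqr_ge0.
Qed.

Lemma norm_rV_le x (r : R) : 0 <= r -> (forall j, `|x 0 j| <= r) -> `|x| <= r.
Proof.
move=> r0 xr; rewrite [leLHS]/Num.norm /= mx_normrE; apply/bigmax_leP; split => //.
by move=> [i j] _ /=; rewrite (ord1 i).
Qed.

Lemma norm_le_enorm x : `|x| <= enorm x.
Proof. by apply: norm_rV_le; [exact: enorm_ge0|exact: coord_le_enorm]. Qed.

Lemma enorm0 : enorm (0 : V) = 0.
Proof. by rewrite -(scale0r (0 : V)) enormZ normr0 mul0r. Qed.

Lemma open_enorm_gt (c : R) : open [set x : V | c < enorm x].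
Proof.
apply: (@open_comp _ _ (@enorm R d) [set r | c < r]); last exact: open_gt.
by move=> x _; exact: continuous_enorm.
Qed.

Lemma closed_enorm_ge (c : R) : closed [set x : V | c <= enorm x].
Proof.
apply: (@closed_comp _ _ (@enorm R d) [set r | c <= r]); last exact: closed_ge.
by move=> x _; exact: continuous_enorm.
Qed.

Lemma enorm_bounded_away (c : R) : 0 < c -> bounded_away [set x : V | c <= enorm x].
Proof.
move=> c0; have := @closed_enorm_ge c; rewrite /bounded_away => /closure_id <- /=.
by rewrite enorm0 leNgt c0.
Qed.

(* sF is a preimage of F for s > 0, so points outside the compact union of the
   closed sets sF have a neighbourhood outside of all of them at once. *)
Lemma closed_dilation F (p q : R) : closed F -> 0 < p ->
  closed (\bigcup_(s in [set s | p <= s <= q]) [set s *: x | x in F]).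
Proof.
move=> cF p0; rewrite -[X in closed X]setCK; apply: open_closedC.
rewrite openE => x xn.
have [] := (compact_near_coveringP _).1 (@segment_compact R p q) _ (nbhs x)
  (fun y s => ~ F (s^-1 *: y)) (nbhs_filter x).
  move=> s /=; rewrite in_itv /= => spq.
  have s0 : s != 0 by rewrite gt_eqF//; case/andP : spq => /(lt_le_trans p0).
  have nF : ~ F (s^-1 *: x).
    move=> Fx; apply: xn; exists s => //; exists (s^-1 *: x) => //.
    by rewrite scalerA divff// scale1r.
  have : (fun sy : R * V => sy.1^-1 *: sy.2) sy @[sy --> (s, x)] --> s^-1 *: x.
    apply: cvgZ; last exact: cvg_snd.
    by apply: cvgV => //; exact: cvg_fst.
  have nF' : nbhs (s^-1 *: x) (~` F).
    by apply: open_nbhs_nbhs; split => //; exact: closed_openC.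
  by move=> /(_ _ nF').
move=> E xE hE; exists E => // y Ey [s /= spq [z Fz zy]].
apply: (hE y Ey s); first by rewrite /= in_itv.
have s0 : s != 0 by rewrite gt_eqF//; case/andP : spq => /(lt_le_trans p0).
by rewrite -zy scalerA mulVf// scale1r.
Qed.

Lemma to_ext_scale (u : R) A : 0 < u ->
  scale_ext u (to_ext A) = to_ext [set u *: x | x in A].
Proof.
move=> u0; apply/seteqP; split => x.
  move=> [y [z Az yz] xy]; exists (u *: z); first by exists z.
  by rewrite xy; apply/rowP => j; rewrite !mxE yz !mxE.
move=> [_ [z Az <-] xz]; have := to_ext_val xz.
rewrite scaler_eq0 gt_eqF//= => /to_ext_ex[y yz].
exists y; first by exists z.
by rewrite xz; apply/rowP => j; rewrite !mxE yz !mxE.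
Qed.

End borel_rV_theory.

(** * Regular variation of the tail *)

Section probability_of_scaled_sets.
Context {dO : measure_display} {Omega : measurableType dO} {R : realType}.
Variable P : probability Omega R.

Definition pr (E : set Omega) : R := fine (P E).

Lemma prE E : measurable E -> (pr E)%:E = P E.
Proof. by move=> mE; rewrite fineK// fin_num_measure. Qed.

Lemma pr_ge0 E : 0 <= pr E. Proof. exact: fine_ge0. Qed.

Lemma le_pr E F : measurable E -> measurable F -> E `<=` F -> pr E <= pr F.
Proof.
by move=> mE mF EF; rewrite -lee_fin !prE//; apply: le_measure; rewrite ?inE.
Qed.

Lemma prU_le E F : measurable E -> measurable F -> pr (E `|` F) <= pr E + pr F.
Proof.
move=> mE mF; rewrite -lee_fin EFinD !prE//; last exact: measurableU.
exact: measureU2.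
Qed.

Lemma pr_bigU_le (I : Type) (s : seq I) (E : I -> set Omega) :
  (forall i, measurable (E i)) ->
  pr (\big[setU/set0]_(i <- s) E i) <= \sum_(i <- s) pr (E i).
Proof.
move=> mE; elim: s => [|i s IH]; first by rewrite !big_nil /pr measure0.
rewrite !big_cons; apply: (le_trans (prU_le (mE i) _)); last by rewrite lerD2l.
exact: bigsetU_measurable.
Qed.

Context (d : nat).
Variable Z : {RV P >-> borel_rV R d}.
Local Notation V := 'rV[R]_d.+1.

Definition tail (u : R) : R := fine (norm_tail Z u).

Definition scaled_pr (u : R) (A : set V) : R := pr [set w | A (u^-1 *: (Z w : V))].

Lemma measurable_RV_set (B : set V) : measurable (B : set (borel_rV R d)) ->
  measurable [set w | B (Z w)].
Proof. by move=> mB; rewrite -[X in measurable X]setTI; exact: measurable_funP. Qed.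

Lemma measurable_RV_scaled (c : R) (B : set V) : measurable (B : set (borel_rV R d)) ->
  measurable [set w | B (c *: (Z w : V))].
Proof.
move=> mB; apply: (measurable_RV_set (B := [set x | B (c *: x)])).
have cf : continuous (fun x : V => c *: x) by exact: scaler_continuous.
by have := continuous_rV_measurable_fun cf measurableT mB; rewrite setTI.
Qed.

Lemma measurable_enorm_gt (u : R) : measurable [set w | u < enorm (Z w : V)].
Proof.
apply: (measurable_RV_set (B := [set x | u < enorm x])).
by apply: measurable_open_rV; exact: open_enorm_gt.
Qed.

Lemma tailE u : tail u = pr [set w | u < enorm (Z w : V)]. Proof. by []. Qed.

Lemma tail_ge0 u : 0 <= tail u. Proof. exact: pr_ge0. Qed.

Lemma tail_anti u v : u <= v -> tail v <= tail u.
Proof.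
move=> uv; apply: le_pr; [exact: measurable_enorm_gt|exact: measurable_enorm_gt|].
by move=> w /=; exact: le_lt_trans.
Qed.

Lemma scaled_pr_enorm (u c : R) : 0 < u ->
  scaled_pr u [set x | c < enorm x] = tail (c * u).
Proof.
move=> u0; congr (fine (P _)); apply/seteqP; split => w /=;
by rewrite enormZ gtr0_norm ?invr_gt0// ltr_pdivlMl// mulrC.
Qed.

Variables (alpha : R) (mu : {measure set borel_ext R d -> \bar R}).
Hypothesis rvZ : regularly_varying Z alpha mu.

Let radon_mu : radon mu. Proof. by case: rvZ. Qed.
Let mu_oo : mu (~` to_ext setT) = 0%E. Proof. by case: rvZ. Qed.

(** By homogeneity the masses of all spheres are positive multiples of that of the unit sphere. The
    disjoint spheres with radii between 1 and 2 lie in a set of finite mass, so one of them is null,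
    and then all are. *)
Lemma mu_sphere (c : R) : 0 < c -> mu (to_ext [set x | enorm x = c]) = 0%E.
Proof.
have cS r : closed [set x : V | enorm x = r].
  apply: (@closed_comp _ _ (@enorm R d) [set s | s = r]); last exact: closed_eq.
  by move=> x _; exact: continuous_enorm.
have mS r : measurable (to_ext [set x : V | enorm x = r] : set (borel_ext R d)).
  exact: measurable_to_ext_closed.
have sphE (r : R) : 0 < r -> mu (to_ext [set x : V | enorm x = r]) =
    ((r `^ (- alpha))%:E * mu (to_ext [set x | enorm x = 1%R]))%E.
  move=> r0; case: rvZ => _ _ _ _ <- //; rewrite to_ext_scale//.
  congr (mu (to_ext _)); apply/seteqP; split => x /=.
    move=> xr; exists (r^-1 *: x); last by rewrite scalerA mulfV ?gt_eqF// scale1r.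
    by rewrite enormZ gtr0_norm ?invr_gt0// xr mulVf// gt_eqF.
  by move=> [y y1 <-]; rewrite enormZ y1 mulr1 gtr0_norm.
have [||||||r /andP[r0 r1] mu0] := @exists_uncharged _ _ _ mu
  (fun r => to_ext [set x : V | enorm x = 1 + r])
  (to_ext [set x : V | 1 <= enorm x]) 1.
- by move=> r; exact: mS.
- by apply: measurable_to_ext_closed; exact: closed_enorm_ge.
- rewrite -ge0_fin_numE//; apply: mu_to_ext_fin_closed => //.
    exact: closed_enorm_ge.
  exact: enorm_bounded_away.
- apply/trivIsetP => i j _ _ ij; rewrite -to_extI; apply/seteqP; split => // x [y].
  by move=> [/= -> /addrI ji]; rewrite ji eqxx in ij.
- by move=> r /andP[r0 _]; apply: to_extS => x /= ->; rewrite lerDl ltW.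
- by [].
move=> c0; rewrite sphE//; move: mu0; rewrite (sphE (1 + r)); last by lra.
move=> /eqP; rewrite mule_eq0 eqe gt_eqF ?powR_gt0//=; last by lra.
by move=> /eqP ->; rewrite mule0.
Qed.

Let H (c : R) := [set x : V | c < enorm x].

Let H_bounded_away c : 0 < c -> bounded_away (H c).
Proof. by move=> c0; apply: bounded_awayS (enorm_bounded_away c0) => x /ltW. Qed.

Let mH c : measurable (to_ext (H c) : set (borel_ext R d)).
Proof. by apply: measurable_to_ext_open; exact: open_enorm_gt. Qed.

Lemma fmass_enorm_ge c : 0 < c -> fmass mu [set x | c <= enorm x] = fmass mu (H c).
Proof.
move=> c0; congr fine; rewrite (_ : [set x | c <= enorm x] = H c `|` [set x | enorm x = c]).
  rewrite to_extU measureU0//; last exact: mu_sphere.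
  apply: measurable_to_ext_closed.
  apply: (@closed_comp _ _ (@enorm R d) [set s | s = c]); last exact: closed_eq.
  by move=> x _; exact: continuous_enorm.
apply/seteqP; split => x /=; first by rewrite le_eqVlt => /orP[/eqP|]; [right|left].
by move=> [/ltW|->].
Qed.

Lemma vague_cvg_fmass (a : nat -> R) (B : set V) :
  vague_cvg (fun n C => n%:R%:E * P [set w | finite_part C ((a n)^-1 *: (Z w : V))])%E mu ->
  measurable (B : set (borel_rV R d)) ->
  measurable (to_ext B : set (borel_ext R d)) -> bounded_away B ->
  mu (boundary (to_ext B)) = 0%E ->
  n%:R * scaled_pr (a n) B @[n --> \oo] --> fmass mu B.
Proof.
move=> vc mB meB B0 bB.
have := vc _ meB (precompact_to_ext B0) bB.
rewrite finite_part_to_ext; last by move=> h; apply: B0; exact: subset_closure.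
rewrite -(fmassE radon_mu)// => /fine_cvgP[_]; apply: cvg_trans.
apply: near_eq_cvg; apply: nearW => n /=.
by rewrite -prE; [rewrite -EFinM|exact: measurable_RV_scaled].
Qed.

Lemma cvg_tail_scaled (a : nat -> R) (c : R) :
  vague_cvg (fun n C => n%:R%:E * P [set w | finite_part C ((a n)^-1 *: (Z w : V))])%E mu ->
  (forall n, 0 < a n) -> 0 < c ->
  n%:R * tail (c * a n) @[n --> \oo] --> fmass mu (H c).
Proof.
move=> vc a0 c0.
have -> : (fun n => n%:R * tail (c * a n)) = (fun n => n%:R * scaled_pr (a n) (H c)).
  by apply/funext => n; rewrite scaled_pr_enorm.
apply: vague_cvg_fmass => //; [|exact: H_bounded_away|].
  by apply: measurable_open_rV; exact: open_enorm_gt.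
apply: (@boundary_to_ext _ _ _ mu_oo [set x | c <= enorm x] (H c)) => //.
- exact: closed_enorm_ge.
- exact: open_enorm_gt.
- by move=> x /ltW.
- rewrite (_ : _ `\` _ = [set x | enorm x = c]); first exact: mu_sphere.
  apply/seteqP; split => x /=; rewrite /H /=.
    by move=> [cx /negP]; rewrite -leNgt => xc; apply/eqP; rewrite eq_le xc cx.
  by move=> ->; split => //; rewrite ltxx.
Qed.

(** The normalization n P(|Z| > a_n) -> 1 fixes the value at c = 1, spheres being null; homogeneity
    does the rest. *)
Lemma fmass_enorm_gt c : 0 < c -> fmass mu (H c) = c `^ (- alpha).
Proof.
have [_ _ _ [a [a0 _ _ a1 vc]] homog] := rvZ.
have H1 : fmass mu (H 1) = 1.
  have h1 := cvg_tail_scaled vc a0 ltr01.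
  have h2 : n%:R * tail (1 * a n) @[n --> \oo] --> (1 : R).
    move/fine_cvgP : a1 => [_]; apply: cvg_trans; apply: near_eq_cvg.
    apply: nearW => n /=; rewrite mul1r /norm_tail -prE; last exact: measurable_enorm_gt.
    by rewrite -EFinM.
  exact: (cvg_unique _ h1 h2).
move=> c0; rewrite /fmass (_ : H c = [set c *: x | x in H 1]).
  rewrite -to_ext_scale// homog// fineM//.
  - by rewrite -/(fmass mu (H 1)) H1 mulr1.
  - by apply: mu_to_ext_fin => //; exact: H_bounded_away.
apply/seteqP; split => x /=.
  rewrite /H /= => cx; exists (c^-1 *: x); last by rewrite scalerA mulfV ?gt_eqF// scale1r.
  by rewrite enormZ gtr0_norm ?invr_gt0// ltr_pdivlMl// mulr1.
by move=> [y]; rewrite /H /= => y1 <-; rewrite enormZ gtr0_norm// ltr_pMr.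
Qed.

Lemma regular_scaling : exists a : nat -> R,
  [/\ (forall n, 0 < a n) /\ {homo a : m n / (m <= n)%N >-> m <= n},
      a n @[n --> \oo] --> +oo,
      (forall c, 0 < c -> n%:R * tail (c * a n) @[n --> \oo] --> c `^ (- alpha)) &
      forall B, closed B -> bounded_away B -> mu (boundary (to_ext B)) = 0%E ->
        n%:R * scaled_pr (a n) B @[n --> \oo] --> fmass mu B].
Proof.
have [_ _ _ [a [a0 amono aoo a1 vc]] homog] := rvZ.
exists a; split => //.
  by move=> c c0; rewrite -fmass_enorm_gt//; exact: cvg_tail_scaled.
move=> B cB B0 bB; apply: vague_cvg_fmass => //.
  exact: measurable_closed_rV.
exact: measurable_to_ext_closed.
Qed.

End probability_of_scaled_sets.

(** * Portmanteau bounds along the integers *)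

Lemma cvg_near_lt (R : realType) (f g : nat -> R) (l k : R) :
  f @ \oo --> l -> g @ \oo --> k -> l < k -> \forall n \near \oo, f n < g n.
Proof.
move=> fl gk lk.
have lm : l < (l + k) / 2 by lra.
have mk : (l + k) / 2 < k by lra.
near=> n; apply: (@lt_trans _ _ ((l + k) / 2)); near: n.
  exact: (cvgr_lt l).
exact: (cvgr_gt k).
Unshelve. all: by end_near. Qed.

(** This carries limits along [a] over to the integers: a monotone tail at n is squeezed between its
    values at [a m] and [a m.+1]. *)
Lemma bracketing (R : realType) (a : nat -> R) :
  {homo a : m n / (m <= n)%N >-> m <= n} -> a n @[n --> \oo] --> +oo ->
  forall M, \forall n \near \oo, exists2 m, (M <= m)%N & a m <= n%:R < a m.+1.
Proof.
move=> amono aoo M; near=> n.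
have aMn : a M <= n%:R by near: n; exact: nbhs_infty_ger.
have [k nk] : exists k, n%:R < a k.
  have [k _ /(_ k (leqnn k))] := cvgry_gt aoo (n%:R).
  by exists k.
pose p := [pred j | n%:R < a j].
have ex : exists j, p j by exists k.
case: (ex_minnP ex) => j /= pj jmin.
have Mj : (M < j)%N.
  rewrite ltnNge; apply/negP => /amono /(lt_le_trans pj) /(le_lt_trans aMn).
  by rewrite ltxx.
exists j.-1; first by rewrite -ltnS (ltn_predK Mj).
rewrite (ltn_predK Mj) pj andbT leNgt; apply/negP => /jmin.
by rewrite leqNgt (ltn_predK Mj) leqnn.
Unshelve. all: by end_near. Qed.

Section integer_scaling.
Context {dO : measure_display} {Omega : measurableType dO} {R : realType}.
Context (P : probability Omega R) (d : nat).
Local Notation V := 'rV[R]_d.+1.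
Variables (Z : {RV P >-> borel_rV R d}) (alpha : R).
Variable (mu : {measure set borel_ext R d -> \bar R}).
Hypothesis alpha_gt0 : 0 < alpha.
Hypothesis rvZ : regularly_varying Z alpha mu.
Implicit Types (F G : set V).

Let radon_mu : radon mu. Proof. by case: rvZ. Qed.
Let mu_oo : mu (~` to_ext setT) = 0%E. Proof. by case: rvZ. Qed.

(** A tail that vanishes at u vanishes beyond u, against n P(|Z| > a_n) -> 1. *)
Lemma tail_gt0 u : 0 < tail Z u.
Proof.
have [a [[a0 amono] aoo acvg _]] := regular_scaling rvZ.
have := acvg 1 ltr01; rewrite powR1 => /cvgr_gt/(_ 0 ltr01) h.
have [n [un /=]] : exists n, u <= a n /\ 0 < n%:R * tail Z (1 * a n).
  near \oo => n; exists n; split; near: n; last exact: h.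
  exact: (cvgry_ge aoo).
have [->|n0] := eqVneq n 0%N; first by rewrite mul0r ltxx.
rewrite pmulr_rgt0 ?ltr0n ?lt0n// mul1r => /lt_le_trans; apply.
exact: tail_anti.
Unshelve. all: by end_near. Qed.

(** Since m/(m+1) -> 1, both ends of a bracket may carry the same factor m, which then cancels when
    they are compared. *)
Lemma tail_shift (a : nat -> R) (c : R) : 0 < c ->
  (forall c, 0 < c -> n%:R * tail Z (c * a n) @[n --> \oo] --> c `^ (- alpha)) ->
  n%:R * tail Z (c * a n.+1) @[n --> \oo] --> c `^ (- alpha).
Proof.
move=> c0 acvg.
have h1 : (n.+1%:R * tail Z (c * a n.+1)) @[n --> \oo] --> c `^ (- alpha).
  by have := acvg c c0; rewrite -cvg_shiftS.
have h2 : 1 - n.+1%:R^-1 @[n --> \oo] --> (1 : R).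
  rewrite -[X in _ --> X]subr0; apply: cvgB; first exact: cvg_cst.
  exact: cvg_harmonic.
have := cvgM h2 h1; rewrite mul1r => h.
suff -> : (fun n => n%:R * tail Z (c * a n.+1)) =
  (fun n => 1 - n.+1%:R^-1) \* (fun n => n.+1%:R * tail Z (c * a n.+1)) by exact: h.
by apply/funext => n /=; rewrite mulrA mulrBl mul1r mulVf// -natr1 addrK.
Qed.

(** For n between [a m] and [a m.+1], the left tail is at most the one at [c * a m] and the right
    tail at least the one at [a m.+1]; multiplied by m, these two have known limits. *)
Lemma tail_integer_le (c e : R) : 0 < c -> 0 < e ->
  \forall n \near \oo, tail Z (c * n%:R) <= (c `^ (- alpha) + e) * tail Z n%:R.
Proof.
move=> c0 e0; have [a [[a0 amono] aoo acvg _]] := regular_scaling rvZ.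
have ca : 0 < c `^ (- alpha) by exact: powR_gt0.
have h : \forall m \near \oo, m%:R * tail Z (c * a m) <
    (c `^ (- alpha) + e) * (m%:R * tail Z (1 * a m.+1)).
  apply: cvg_near_lt (acvg c c0) _ _.
    by apply: cvgMr; exact: (tail_shift ltr01 acvg).
  by rewrite powR1 mulr1; lra.
have [M _ hM] := h; apply: filterS (bracketing amono aoo M.+1).
move=> n [m Mm /andP[amn nam]].
have m0 : (0 : R) < m%:R by rewrite ltr0n; exact: leq_trans Mm.
have := hM m (ltnW Mm); rewrite /= mulrCA ltr_pM2l// mul1r => hm.
apply: (@le_trans _ _ (tail Z (c * a m))).
  by apply: tail_anti; rewrite ler_pM2l.
apply: (le_trans (ltW hm)); apply: ler_wpM2l; first lra.
by apply: tail_anti; exact: ltW.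
Qed.

Lemma tail_integer_ge (c e : R) : 0 < c -> 0 < e ->
  \forall n \near \oo, (c `^ (- alpha) - e) * tail Z n%:R <= tail Z (c * n%:R).
Proof.
move=> c0 e0; have [a [[a0 amono] aoo acvg _]] := regular_scaling rvZ.
(* Only a nonnegative coefficient preserves the comparison of tails; otherwise the left-hand side is
   at most 0. *)
have [ce|ce] := leP (c `^ (- alpha) - e) 0.
  apply: nearW => n; apply: (@le_trans _ _ 0); last exact: tail_ge0.
  by rewrite mulr_le0_ge0//; exact: tail_ge0.
have h : \forall m \near \oo, (c `^ (- alpha) - e) * (m%:R * tail Z (1 * a m)) <
    m%:R * tail Z (c * a m.+1).
  apply: cvg_near_lt (tail_shift c0 acvg) _.
    by apply: cvgMr; exact: (acvg _ ltr01).
  by rewrite powR1 mulr1; lra.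
have [M _ hM] := h; apply: filterS (bracketing amono aoo M.+1).
move=> n [m Mm /andP[amn nam]].
have m0 : (0 : R) < m%:R by rewrite ltr0n; exact: leq_trans Mm.
have := hM m (ltnW Mm); rewrite /= mulrCA ltr_pM2l// mul1r => hm.
apply: (@le_trans _ _ (tail Z (c * a m.+1))); last first.
  by apply: tail_anti; rewrite ler_pM2l// ltW.
apply: (le_trans _ (ltW hm)); apply: ler_wpM2l; first lra.
exact: tail_anti.
Qed.

(* Some a_{m+1}/a_m > 1+e would give P(|Z| > a_{m+1}) <= P(|Z| > (1+e) a_m),
   although m times these tend to 1 and to (1+e)^-alpha < 1. *)
Lemma scaling_ratio (a : nat -> R) (e : R) : 0 < e -> (forall n, 0 < a n) ->
  (forall c, 0 < c -> n%:R * tail Z (c * a n) @[n --> \oo] --> c `^ (- alpha)) ->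
  \forall m \near \oo, a m.+1 <= (1 + e) * a m.
Proof.
move=> e0 a0 acvg.
have e1 : 0 < 1 + e by lra.
have : \forall m \near \oo, m%:R * tail Z ((1 + e) * a m) < m%:R * tail Z (1 * a m.+1).
  apply: cvg_near_lt (acvg _ e1) (tail_shift ltr01 acvg) _.
  rewrite powR1 powRN invf_lt1 ?powR_gt0//.
  have := @gt0_ltr_powR _ _ alpha_gt0 1 (1 + e); rewrite !nnegrE powR1; apply; lra.
move=> [M _ hM]; exists M => // m Mm; have := hM m Mm => /= h.
rewrite leNgt; apply/negP => am; have : m%:R * tail Z (1 * a m.+1) <= m%:R * tail Z ((1 + e) * a m).
  by apply: ler_wpM2l => //; apply: tail_anti; rewrite mul1r ltW.
by rewrite leNgt h.
Qed.

Definition dilation (F : set V) (p q : R) :=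
  \bigcup_(s in [set s | p <= s <= q]) [set s *: x | x in F].

Lemma scaled_pr_closed_le F (e : R) : closed F -> bounded_away F -> 0 < e ->
  \forall n \near \oo, scaled_pr Z n%:R F <= (fmass mu F + e) * tail Z n%:R.
Proof.
move=> cF F0 e0; have [a [[a0 amono] aoo acvg Bcvg]] := regular_scaling rvZ.
have [dl dl0 Fdl] := bounded_away_ball F0.
(* If a_m <= n < a_{m+1}, then n / a_m is eventually in [1, 1 + 1/(k+1)], so Z / n in [F] puts Z /
   a_m in [D k]. The enlargement [F'] of [D k] has a null boundary, so vague convergence applies to
   it. *)
pose D k := dilation F 1 (1 + k.+1%:R^-1).
have cD k : closed (D k) by exact: closed_dilation.
have D0 k : bounded_away (D k).
  apply: (@ball_bounded_away _ _ _ dl) => // y [s /= /andP[s1 _] [x Fx <-]].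
  apply: (le_trans (Fdl _ Fx)); rewrite normrZ ger0_norm ?(le_trans _ s1)//.
  by rewrite ler_peMl.
have capD : \bigcap_k D k = F.
  apply/seteqP; split => x; last first.
    move=> Fx k _; exists 1; first by apply/andP; split => //; rewrite lerDl invr_ge0 ler0n.
    by exists x => //; rewrite scale1r.
  move=> Dx; rewrite (closure_id F).1//; move=> B /nbhs_ballP[r /= r0 rB].
  have [k xk] : exists k : nat, `|x| * k.+1%:R^-1 < r.
    have x1 : 0 < `|x| + 1 by rewrite ltr_wpDl.
    have [k] := ltr_add_invr (divr_gt0 r0 x1).
    rewrite add0r ltr_pdivlMr// mulrC => xk; exists k; apply: le_lt_trans xk.
    by rewrite ler_wpM2r// lerDl.
  have [s /= /andP[s1 sk] [y Fy yx]] := Dx k I.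
  exists y; split => //; apply: rB; rewrite -ball_normE /= -yx.
  rewrite -[X in _ - X]scale1r -scalerBl normrZ; apply: le_lt_trans xk.
  rewrite mulrC ler_pM//; last by rewrite ger0_norm ?subr_ge0// lerBlDl.
  rewrite -yx normrZ ger0_norm; last lra.
  by rewrite ler_peMl.
have [|k hk] := fmass_bigcap radon_mu cD _ (D0 0%N) (divr_gt0 e0 (ltr0n R 3)).
  move=> n m nm x [s /= /andP[s1 sm] sx]; exists s => //=; rewrite s1 (le_trans sm)//.
  by rewrite lerD2l lef_pV2 ?posrE// ler_nat.
rewrite capD in hk.
have [F' [r [r0 [cF' F'0] F'r hF' bF']]] :=
  closed_nbhd radon_mu mu_oo (cD k) (D0 k) (divr_gt0 e0 (ltr0n R 3)).
have DF' : D k `<=` F' by move=> x Dx; apply: (F'r _ x) => //; rewrite subrr normr0.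
have h : \forall m \near \oo, m%:R * scaled_pr Z (a m) F' <
    (fmass mu F + e) * (m%:R * tail Z (1 * a m.+1)).
  apply: cvg_near_lt (Bcvg _ cF' F'0 bF') _ _.
    by apply: cvgMr; exact: (tail_shift ltr01 acvg).
  by rewrite powR1 mulr1; lra.
have [M1 _ hM1] := h.
have [M2 _ hM2] := scaling_ratio (ltr0n R 1) a0 acvg.
have k0 : (0 : R) < k.+1%:R^-1 by [].
have [M3 _ hM3] := scaling_ratio k0 a0 acvg.
apply: filterS (bracketing amono aoo (maxn M1 M3).+1).
move=> n [m]; rewrite gtn_max => /andP[Mm1 Mm3] /andP[amn nam].
have m0 : (0 : R) < m%:R by rewrite ltr0n; exact: leq_ltn_trans Mm1.
have n0 : (0 : R) < n%:R by exact: lt_le_trans amn.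
have := hM1 m (ltnW Mm1); rewrite /= mulrCA ltr_pM2l// mul1r => hm.
have := hM3 m (ltnW Mm3); rewrite /= => ram.
apply: (@le_trans _ _ (scaled_pr Z (a m) F')).
  apply: le_pr.
  - by apply: measurable_RV_scaled; exact: measurable_closed_rV.
  - by apply: measurable_RV_scaled; exact: measurable_closed_rV.
  move=> w /= Fw; apply: DF'; exists (n%:R / a m).
    rewrite /= ler_pdivlMr// mul1r amn ler_pdivrMr//.
    by rewrite (le_trans (ltW nam)).
  exists (n%:R^-1 *: (Z w : V)) => //.
  by rewrite scalerA mulrAC mulfV ?mul1r// gt_eqF.
apply: (le_trans (ltW hm)); apply: ler_wpM2l; first by rewrite addr_ge0 ?fmass_ge0// ltW.
by apply: tail_anti; exact: ltW.
Qed.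

(** Outside a ball both the total mass, c^-alpha, and the total probability, a tail, are known; the
    closed complement of [G] there is subtracted with its upper bound. Spheres being null, > c and
    >= c give the same mass. *)
Lemma scaled_pr_open_ge G (e : R) : open G -> bounded_away G -> 0 < e ->
  \forall n \near \oo, (fmass mu G - e) * tail Z n%:R <= scaled_pr Z n%:R G.
Proof.
move=> oG G0 e0; have [dl dl0 Gdl] := bounded_away_ball G0.
pose c := dl / 2; have c0 : 0 < c by rewrite divr_gt0.
pose K := [set x : V | c <= enorm x].
have cK : closed K by exact: closed_enorm_ge.
have K0 : bounded_away K by exact: enorm_bounded_away.
have GK : G `<=` K.
  move=> x /Gdl xdl; apply: le_trans (norm_le_enorm x); apply: le_trans xdl.
  by rewrite /c; lra.
have cF : closed (K `\` G) by apply: closedI => //; exact: open_closedC.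
have F0 : bounded_away (K `\` G) by apply: bounded_awayS K0 => x [].
have mK : measurable (to_ext K : set (borel_ext R d)) by exact: measurable_to_ext_closed.
have mG : measurable (to_ext G : set (borel_ext R d)) by exact: measurable_to_ext_open.
have mF : measurable (to_ext (K `\` G) : set (borel_ext R d)) by exact: measurable_to_ext_closed.
have massE : fmass mu G + fmass mu (K `\` G) = c `^ (- alpha).
  rewrite -(fmass_enorm_gt rvZ c0) -(fmass_enorm_ge rvZ c0) -/K.
  apply: EFin_inj; rewrite EFinD !fmassE//.
  rewrite -measureU//; first by rewrite -to_extU setDUK.
  by rewrite -to_extI setDIK; apply/seteqP; split => // x [].
near=> n.
have n0 : (0 : R) < n%:R by rewrite ltr0n; near: n; exact: nbhs_infty_gt.
have h1 : (c `^ (- alpha) - e / 2) * tail Z n%:R <= tail Z (c * n%:R).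
  by near: n; apply: tail_integer_ge => //; rewrite divr_gt0.
have h2 : scaled_pr Z n%:R (K `\` G) <= (fmass mu (K `\` G) + e / 2) * tail Z n%:R.
  by near: n; apply: scaled_pr_closed_le => //; rewrite divr_gt0.
have h3 : tail Z (c * n%:R) <= scaled_pr Z n%:R G + scaled_pr Z n%:R (K `\` G).
  rewrite -scaled_pr_enorm//.
  have mRG : measurable [set w | G (n%:R^-1 *: (Z w : V))].
    by apply: measurable_RV_scaled; exact: measurable_open_rV.
  have mRF : measurable [set w | (K `\` G) (n%:R^-1 *: (Z w : V))].
    by apply: measurable_RV_scaled; exact: measurable_closed_rV.
  apply: le_trans (prU_le P mRG mRF); apply: le_pr.
  - by apply: measurable_RV_scaled; apply: measurable_open_rV; exact: open_enorm_gt.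
  - exact: measurableU.
  - move=> w /= /ltW cw; have [?|?] := pselect (G (n%:R^-1 *: (Z w : V))); first by left.
    by right; split.
have : (fmass mu G - e) * tail Z n%:R =
    (c `^ (- alpha) - e / 2) * tail Z n%:R - (fmass mu (K `\` G) + e / 2) * tail Z n%:R.
  by rewrite -massE; lra.
lra.
Unshelve. all: by end_near. Qed.

End integer_scaling.

(** * Choice of the truncation level *)

Section truncation_level.
Context (R : realType).

Lemma exists_expr_lt (x e : R) : 0 <= x < 1 -> 0 < e -> exists n0, forall n, (n0 <= n)%N -> x ^+ n < e.
Proof.
move=> /andP[x0 x1] e0.
have : (fun n => x ^+ n) @ \oo --> (0 : R) by apply: cvg_expr; rewrite ger0_norm.
by move=> /cvgr_lt/(_ e e0)[N _ hN]; exists N.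
Qed.

Variables (f : nat -> R) (sigma rho : R).
Hypothesis f_gt0 : forall n, 0 < f n.
Hypothesis f_anti : forall m n, (m <= n)%N -> f n <= f m.
Hypothesis sigma01 : 0 < sigma <= 1.
Hypothesis rho_gt0 : 0 < rho.
Hypothesis rho_lt : 2 * rho < 1.
Hypothesis f_double : \forall n \near \oo, sigma * f n <= f (2 * n)%N <= rho * f n.

(** Along powers of two, doubling confines [f] between geometric sequences of ratios [sigma] and
    [rho]; as 2 rho < 1, even 2^k f(2^k) decays geometrically. *)
Let f_double2 : exists k0, forall k, (k0 <= k)%N ->
  sigma * f (2 ^ k)%N <= f (2 ^ k.+1)%N <= rho * f (2 ^ k)%N.
Proof.
have [N _ hN] := f_double; exists N => k Nk; rewrite expnS; apply: hN.
by rewrite /= (leq_trans Nk)// ltnW// ltn_expl.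
Qed.

Let f_upper : exists2 C, 0 < C & forall k, f (2 ^ k)%N <= C * rho ^+ k.
Proof.
have [k0 hk] := f_double2; have r1 : rho <= 1.
  by apply/ltW; apply: le_lt_trans rho_lt; rewrite ler_peMl ?ler1n// ltW.
(* Dividing by rho^k0 absorbs the first terms, where the doubling bound may fail. *)
exists (f 0%N / rho ^+ k0); first by rewrite divr_gt0 ?exprn_gt0.
have small k : (k <= k0)%N -> f (2 ^ k)%N <= f 0%N / rho ^+ k0 * rho ^+ k.
  move=> kk0; rewrite mulrAC ler_pdivlMr ?exprn_gt0//; apply: ler_pM => //.
  - exact: ltW.
  - by rewrite exprn_ge0// ltW.
  - exact: f_anti.
  - by rewrite ler_wiXn2l// ltW.
elim=> [|k IH]; first exact: small.
have [kk0|k0k] := ltnP k k0; first exact: small.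
have /andP[_ h] := hk k k0k; apply: (le_trans h).
by rewrite exprS mulrCA ler_pM2l.
Qed.

Let f_lower : exists2 c, 0 < c & forall k, c * sigma ^+ k <= f (2 ^ k)%N.
Proof.
have [k0 hk] := f_double2; have /andP[s0 s1] := sigma01.
exists (f (2 ^ k0)%N) => //.
have small k : (k <= k0)%N -> f (2 ^ k0)%N * sigma ^+ k <= f (2 ^ k)%N.
  move=> kk0; apply: (@le_trans _ _ (f (2 ^ k0)%N)).
    by apply: ler_piMr; [exact: ltW|rewrite exprn_ile1// ltW].
  by apply: f_anti; rewrite leq_exp2l.
elim=> [|k IH]; first exact: small.
have [kk0|k0k] := ltnP k k0; first exact: small.
have /andP[h _] := hk k k0k; apply: le_trans h.
by rewrite exprS mulrCA ler_pM2l.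
Qed.

(* With 2^k <= n < 2^(k+1) and q = k %/ M for a large constant M, the level is
   u n = 2^(k-q): then n/u >= 2^q, n f(u) decays like beta^q with beta < 1, and
   n f(n) decays at most geometrically in q. *)
Lemma truncation_level : exists L (u : nat -> nat),
  [/\ [/\ (forall n, 0 < u n)%N, (forall K, \forall n \near \oo, (K <= u n)%N) &
       forall e : R, 0 < e -> \forall n \near \oo, (u n)%:R <= e * n%:R],
      (forall e, 0 < e -> \forall n \near \oo, n%:R * f n <= e),
      (forall e, 0 < e -> \forall n \near \oo, (n%:R * f (u n)) ^+ L <= e * (n%:R * f n)) &
      (forall theta e, 0 < theta -> 0 < e -> \forall n \near \oo,
        n%:R ^+ 2 * expR (- (theta * (n%:R / (u n)%:R))) <= e * (n%:R * f n))].
Proof.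
have [C C0 fC] := f_upper; have [c c0 fc] := f_lower.
have /andP[s0 s1] := sigma01.
have r2 : 0 < 2 * rho by rewrite mulr_gt0.
have [m0 hm0] : exists n0, forall n, (n0 <= n)%N -> (2 * rho) ^+ n < rho.
  by apply: exists_expr_lt => //; rewrite rho_lt ltW.
(* Lowering the level by q powers of two costs rho^-q, which (2 rho)^k outweighs as k >= M q: this
   yields [beta]. With M > 1, q <= k - q, so the level still tends to infinity. *)
have [M M2 hM] : exists2 M, (1 < M)%N & (2 * rho) ^+ M < rho.
  by exists m0.+2 => //; apply: hm0; rewrite ltnW.
have M0 : (0 < M)%N by exact: ltnW.
pose beta := (2 * rho) ^+ M / rho.
have b0 : 0 < beta by rewrite divr_gt0// exprn_gt0.
have b1 : beta < 1 by rewrite ltr_pdivrMr// mul1r.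
have sM0 : 0 < sigma ^+ M by rewrite exprn_gt0.
(* n f(n) is at least a constant times (sigma^M)^q, so L must make (beta^q)^L smaller than that. *)
have [L hL] : exists n0, forall n, (n0 <= n)%N -> beta ^+ n < sigma ^+ M.
  by apply: exists_expr_lt => //; rewrite b1 ltW.
pose k n := trunc_log 2 n; pose q n := (k n %/ M)%N.
pose u n := (2 ^ (k n - q n))%N.
have kb n : (0 < n)%N -> (2 ^ k n <= n < 2 ^ (k n).+1)%N by move=> n0; exact: trunc_log_bounds.
have qk n : (M * q n <= k n)%N by rewrite mulnC leq_divM.
have kq n : (k n < M * (q n).+1)%N by rewrite mulnC ltn_ceil.
have q2 n : (q n <= k n - q n)%N.
  have : (2 * q n <= k n)%N by apply: leq_trans (qk n); rewrite leq_mul2r M2 orbT.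
  by clear; move: (q n) (k n) => i j; lia.
have qlek n : (q n <= k n)%N by apply: (leq_trans (q2 n)); exact: leq_subr.
have qoo Q : \forall n \near \oo, (Q <= q n)%N /\ (0 < n)%N.
  exists (2 ^ (M * Q))%N => //= n Mn; split.
    by rewrite leq_divRL// mulnC; apply: trunc_log_max.
  by apply: leq_trans Mn; rewrite expn_gt0.
have up n : (0 < n)%N -> n%:R * f (u n) <= 2 * C * beta ^+ q n.
  move=> n0; have /andP[_ nk] := kb n n0.
  apply: (@le_trans _ _ (2 ^+ (k n).+1 * (C * rho ^+ (k n - q n)))).
    apply: ler_pM => //; first exact: ltW.
    - by rewrite -natrX ler_nat ltnW.
    - exact: fC.
  have -> : 2 ^+ (k n).+1 * (C * rho ^+ (k n - q n)) = 2 * C * ((2 * rho) ^+ k n / rho ^+ q n).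
    rewrite exprS exprMn exprB//; last by rewrite unitfE gt_eqF.
    by ring.
  rewrite ler_pM2l ?mulr_gt0// /beta expr_div_n -exprM.
  rewrite ler_pM2r ?invr_gt0 ?exprn_gt0//.
  by apply: ler_wiXn2l => //; exact: ltW.
have lo n : (0 < n)%N -> c * sigma ^+ M * (sigma ^+ M) ^+ q n <= n%:R * f n.
  move=> n0; have /andP[nk1 nk] := kb n n0.
  apply: (@le_trans _ _ (f (2 ^ (k n).+1)%N)).
    apply: le_trans (fc _); rewrite -mulrA ler_pM2l//.
    rewrite -exprS -exprM; apply: ler_wiXn2l => //; exact: ltW.
  apply: (@le_trans _ _ (1 * f n)); first by rewrite mul1r; apply: f_anti; exact: ltnW.
  by rewrite ler_pM2r// ler1n.
exists L, u; split.
- split; [by move=> n; rewrite expn_gt0| |].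
    move=> K; apply: filterS (qoo K) => n [Kq _].
    by apply: (leq_trans Kq); apply: (leq_trans (q2 n)); rewrite ltnW// ltn_expl.
  move=> e e0.
  have [Q hQ] : exists Q, forall i, (Q <= i)%N -> (1 / 2 : R) ^+ i < e.
    by apply: exists_expr_lt => //; lra.
  apply: filterS (qoo Q) => n [Qq n0]; have /andP[nk1 _] := kb n n0.
  apply: (@le_trans _ _ ((1 / 2) ^+ q n * 2 ^+ k n)).
    rewrite /u natrX expr_div_n expr1n div1r exprB//; last by rewrite unitfE pnatr_eq0.
    by rewrite mulrC.
  apply: ler_pM; rewrite ?exprn_ge0//; first by apply/ltW/hQ.
  by rewrite -natrX ler_nat.
- move=> e e0.
  have [Q hQ] : exists Q, forall j, (Q <= j)%N -> beta ^+ j < e / (2 * C).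
    by apply: exists_expr_lt; [rewrite b1 ltW|rewrite divr_gt0// mulr_gt0].
  apply: filterS (qoo Q) => n [Qq n0].
  apply: (@le_trans _ _ (n%:R * f (u n))).
    apply: ler_wpM2l => //; apply: f_anti.
    have /andP[nk1 nk] := kb n n0; apply: leq_trans nk1.
    by rewrite leq_exp2l// leq_subr.
  apply: (le_trans (up n n0)); have := hQ _ Qq.
  by rewrite ltr_pdivlMr ?mulr_gt0// mulrC => /ltW.
- move=> e e0.
  pose w := beta ^+ L / sigma ^+ M.
  have w0 : 0 <= w by rewrite divr_ge0 ?exprn_ge0// ltW.
  have w1 : w < 1 by rewrite ltr_pdivrMr// mul1r; exact: hL.
  have C2 : 0 < (2 * C) ^+ L by rewrite exprn_gt0// mulr_gt0.
  have [Q hQ] : exists Q, forall j, (Q <= j)%N -> w ^+ j < e * (c * sigma ^+ M) / (2 * C) ^+ L.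
    by apply: exists_expr_lt; [rewrite w1 w0|rewrite divr_gt0// mulr_gt0// mulr_gt0].
  apply: filterS (qoo Q) => n [Qq n0].
  apply: (@le_trans _ _ (e * (c * sigma ^+ M * (sigma ^+ M) ^+ q n))); last first.
    by rewrite ler_pM2l//; exact: lo.
  apply: (@le_trans _ _ ((2 * C * beta ^+ q n) ^+ L)).
    by apply: lerXn2r; rewrite ?nnegrE ?mulr_ge0 ?exprn_ge0 ?up// ltW.
  rewrite exprMn -[(beta ^+ q n) ^+ L]exprM mulnC exprM.
  have := hQ _ Qq; rewrite /w expr_div_n ltr_pdivlMr// mulrAC.
  by rewrite ltr_pdivrMr ?exprn_gt0// => /ltW h; rewrite [leLHS]mulrC mulrA.
- move=> theta e t0 e0.
  (* Here n^2 is at most 4^M (4^M)^q, so its quotient by the lower bound of n f(n) grows like K^q.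
     The term of degree j+1 in the series of exp(theta 2^q) grows like (2^(j+1))^q; choosing 2^(j+1)
     > 2 K leaves a spare factor 2^-q. *)
  pose K := 4 ^+ M / sigma ^+ M.
  have K0 : 0 < K by rewrite divr_gt0// exprn_gt0.
  have [j hj] : exists j, 2 * K < 2 ^+ j.+1.
    have [j hj] : exists n0, forall n, (n0 <= n)%N -> (1 / 2 : R) ^+ n < 1 / K.
      by apply: exists_expr_lt; [lra|rewrite divr_gt0].
    exists j; have := hj j (leqnn _); rewrite expr_div_n expr1n.
    rewrite !div1r ltf_pV2 ?posrE ?exprn_gt0// exprS; lra.
  pose D := theta ^+ j.+1 / (j.+1)`!%:R.
  have D0 : 0 < D by rewrite divr_gt0 ?exprn_gt0// ltr0n fact_gt0.
  have [Q hQ] : exists Q, forall i, (Q <= i)%N -> (1 / 2) ^+ i < e * c * sigma ^+ M / 4 ^+ M * D.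
    apply: exists_expr_lt; first by lra.
    by rewrite mulr_gt0// divr_gt0 ?exprn_gt0// mulr_gt0// mulr_gt0.
  apply: filterS (qoo Q) => n [Qq n0].
  have /andP[nk1 nk] := kb n n0.
  apply: (@le_trans _ _ (e * (c * sigma ^+ M * (sigma ^+ M) ^+ q n))); last first.
    by rewrite ler_pM2l//; exact: lo.
  apply: (@le_trans _ _ (4 ^+ M * (4 ^+ M) ^+ q n * expR (- (theta * 2 ^+ q n)))).
    apply: ler_pM; rewrite ?exprn_ge0 ?expR_ge0//.
      have -> : (4 : R) = 2 ^+ 2 by rewrite expr2; lra.
      have -> : (2 ^+ 2) ^+ M * ((2 ^+ 2) ^+ M) ^+ q n = ((2 : R) ^+ (M * (q n).+1)) ^+ 2.
        by rewrite -!exprM -exprD; congr (_ ^+ _); ring.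
      apply: lerXn2r; rewrite ?nnegrE// ?exprn_ge0//.
      rewrite -natrX ler_nat; apply: (leq_trans (ltnW nk)).
      by rewrite leq_exp2l//; exact: kq.
    rewrite ler_expR lerN2 ler_pM2l// ler_pdivlMr ?ltr0n ?expn_gt0//.
    rewrite -!natrX -natrM ler_nat -expnD subnKC//.
  rewrite expRN ler_pdivrMr ?expR_gt0//.
  apply: (@le_trans _ _ (e * (c * sigma ^+ M * (sigma ^+ M) ^+ q n) * (D * (2 ^+ j.+1) ^+ q n))); last first.
    apply: ler_wpM2l.
      by rewrite !mulr_ge0 ?exprn_ge0// ltW.
    have x0 : 0 <= theta * 2 ^+ q n by rewrite mulr_ge0 ?exprn_ge0// ltW.
    apply: le_trans (expR_ge1Dxn j x0); rewrite exprMn /D -!exprM (mulnC j.+1) mulrAC.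
    by rewrite lerDr.
  have hq := hQ _ Qq.
  have h2 : (2 * K) ^+ q n <= (2 ^+ j.+1) ^+ q n.
    by apply: lerXn2r; rewrite ?nnegrE; [rewrite mulr_ge0// ltW|rewrite exprn_ge0|exact: ltW].
  have h3 : (4 ^+ M) ^+ q n = (sigma ^+ M) ^+ q n * K ^+ q n.
    by rewrite -exprMn /K mulrCA mulfV ?mulr1// gt_eqF.
  have h4 : 1 <= e * c * sigma ^+ M / 4 ^+ M * D * 2 ^+ q n.
    have := hq; rewrite expr_div_n expr1n ltr_pdivrMr ?exprn_gt0// => /ltW; exact.
  rewrite h3.
  apply: (@le_trans _ _ (e * (c * sigma ^+ M * (sigma ^+ M) ^+ q n) * (D * (2 * K) ^+ q n))); last first.
    apply: ler_wpM2l; first by rewrite !mulr_ge0 ?exprn_ge0// ltW.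
    by rewrite ler_pM2l.
  have -> : e * (c * sigma ^+ M * (sigma ^+ M) ^+ q n) * (D * (2 * K) ^+ q n) =
    (4 ^+ M * ((sigma ^+ M) ^+ q n * K ^+ q n)) * (e * c * sigma ^+ M / 4 ^+ M * D * 2 ^+ q n).
    rewrite exprMn; field.
    by rewrite expf_neq0// pnatr_eq0.
  by rewrite ler_peMr// !mulr_ge0 ?exprn_ge0// ltW.
Qed.

End truncation_level.

(** * Expectation of products of i.i.d. factors *)

Import HBNNSimple.

Section weighted_change_of_variables.
Context {d1 d2 : measure_display} {Om : measurableType d1} {T : measurableType d2}.
Context {R : realType}.
Implicit Types (f : T -> R) (H : Om -> R).

Lemma integral_simple_weighted (P : {measure set Om -> \bar R}) (X : Om -> T) H
    (g : {nnsfun T >-> R}) :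
  measurable_fun setT X -> measurable_fun setT H -> (forall w, 0 <= H w) ->
  (\int[P]_w (g (X w) * H w)%:E =
   \sum_(y \in range g) y%:E * \int[P]_w (\1_(g @^-1` [set y]) (X w) * H w)%:E)%E.
Proof.
move=> mX mH H0.
have m1 y : measurable_fun setT (fun w => (\1_(g @^-1` [set y]) (X w) * H w)%:E).
  apply/measurable_EFinP; apply: measurable_funM => //.
  apply: (measurableT_comp (f := \1_(g @^-1` [set y]) : T -> R)) => //.
have -> : (fun w => (g (X w) * H w)%:E) = (fun w =>
    \sum_(y \in range g) (y * (\1_(g @^-1` [set y]) (X w) * H w))%:E)%E.
  apply/funext => w; rewrite fimfunE !fsbig_finite//= sumEFin; congr (_%:E).
  by rewrite mulr_suml; apply: eq_bigr => y _; rewrite mulrA.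
(* The interchange of sum and integral wants nonnegative terms for every y, including those outside
   the range; on the range the maximum with 0 changes nothing. *)
have -> : (fun w => \sum_(y \in range g) (y * (\1_(g @^-1` [set y]) (X w) * H w))%:E)%E =
   (fun w => \sum_(y \in range g) (Num.max y 0 * (\1_(g @^-1` [set y]) (X w) * H w))%:E)%E.
  apply/funext => w; apply: eq_fsbigr => y; rewrite inE => -[x _ <-].
  by rewrite max_l.
rewrite ge0_integral_fsum//; last 2 first.
- move=> y; under eq_fun do rewrite EFinM.
  by apply: emeasurable_funM => //.
- move=> y w _; rewrite lee_fin !mulr_ge0//.
  by rewrite le_max lexx orbT.
apply: eq_fsbigr => y; rewrite inE => -[x _ <-]; rewrite max_l//.
under eq_integral do rewrite EFinM.
by rewrite ge0_integralZl_EFin// => w _; rewrite lee_fin mulr_ge0.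
Qed.

(* For H a product of functions of the other variables, this peels one factor
   off the expectation of a product without building a product measure. *)
Lemma integral_weighted (P : {measure set Om -> \bar R}) (X : Om -> T) H
    (nu : {measure set T -> \bar R}) (c : R) f :
  measurable_fun setT X -> measurable_fun setT H -> (forall w, 0 <= H w) -> 0 <= c ->
  (forall B, measurable B -> \int[P]_w (\1_B (X w) * H w)%:E = c%:E * nu B)%E ->
  measurable_fun setT f -> (forall x, 0 <= f x) ->
  (\int[P]_w (f (X w) * H w)%:E = c%:E * \int[nu]_x (f x)%:E)%E.
Proof.
move=> mX mH H0 c0 hB mf f0.
have mEf : measurable_fun setT (fun x => (f x)%:E) by exact/measurable_EFinP.
have [|g [ndg gf]] := approximation measurableT mEf _; first by move=> x _; rewrite lee_fin.
have simple n : (\int[P]_w (g n (X w) * H w)%:E = c%:E * \int[nu]_x (g n x)%:E)%E.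
  rewrite integral_simple_weighted//.
  under eq_fsbigr do rewrite hB//.
  rewrite integralT_nnsfun sintegralE ge0_mule_fsumr; last first.
    by move=> y; exact: nnsfun_mulemu_ge0.
  by apply: eq_fsbigr => y _; rewrite muleCA.
have cP : (fun n => \int[P]_w (g n (X w) * H w)%:E)%E @ \oo --> (\int[P]_w (f (X w) * H w)%:E)%E.
  rewrite (_ : (fun w => (f (X w) * H w)%:E) = fun w => limn (fun n => (g n (X w) * H w)%:E)).
    apply: cvg_monotone_convergence => //.
    - move=> n; apply/measurable_EFinP; apply: measurable_funM => //.
      exact: (measurableT_comp (f := g n)).
    - by move=> n w _; rewrite lee_fin mulr_ge0.
    - move=> w _ n m nm; rewrite lee_fin ler_wpM2r//.
      by have /lefP := ndg n m nm; apply.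
  apply/funext => w; apply/esym/cvg_lim => //.
  under eq_fun do rewrite EFinM; rewrite EFinM.
  apply: cvgeM; [exact: mule_def_fin|exact: gf|exact: cvg_cst].
have cN : (fun n => c%:E * \int[nu]_x (g n x)%:E)%E @ \oo --> (c%:E * \int[nu]_x (f x)%:E)%E.
  apply: cvgeZl => //.
  rewrite (_ : (fun x => (f x)%:E) = fun x => limn (fun n => (g n x)%:E)).
    apply: cvg_monotone_convergence => //.
    - by move=> n; apply/measurable_EFinP.
    - by move=> n w _; rewrite lee_fin.
    - by move=> w _ n m nm; rewrite lee_fin; have /lefP := ndg n m nm; apply.
  by apply/funext => x; apply/esym/cvg_lim => //; exact: gf.
have e : (fun n => \int[P]_w (g n (X w) * H w)%:E)%E = (fun n => c%:E * \int[nu]_x (g n x)%:E)%E.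
  by apply/funext.
by rewrite e in cP; exact: (cvg_unique _ cP cN).
Qed.

End weighted_change_of_variables.

Section iid_product.
Context {dO d' : measure_display} {Omega : measurableType dO} {T : measurableType d'}.
Context {R : realType} (P : probability Omega R).
Variable X : nat -> {RV P >-> T}.
Hypothesis indepX : mutually_independent X.
Hypothesis idX : identically_distributed X.

Lemma prod_indic (s : seq nat) (B : nat -> set T) w :
  \prod_(i <- s) \1_(B i) (X i w) =
  \1_(\bigcap_(i in [set` s]) (X i @^-1` B i)) w :> R.
Proof.
elim: s => [|i s IH].
  by rewrite big_nil indicE mem_set// => i.
rewrite big_cons IH !indicE -natrM mulnb; congr ((nat_of_bool _)%:R); apply/idP/idP.
  move=> /andP[]; rewrite !inE => Bi Bs j /=; rewrite inE => /orP[/eqP -> //|]; exact: Bs.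
rewrite !inE => h; apply/andP; split; rewrite inE.
  by apply: (h i); rewrite /= inE eqxx.
by move=> j js; apply: (h j); rewrite /= inE; apply/orP; right.
Qed.

(* The indicators over J' strengthen the induction on J: they provide the
   hypothesis of integral_weighted. *)
Lemma integral_iid_prod_indic (f : T -> R) (m : R) (J J' : seq nat) (B : nat -> set T) :
  measurable_fun setT f -> (forall x, 0 <= f x) -> (\int[P]_w (f (X 0%N w))%:E = m%:E)%E ->
  uniq (J ++ J') -> (forall i, measurable (B i)) ->
  (\int[P]_w (\prod_(i <- J) f (X i w) * \prod_(i <- J') \1_(B i) (X i w))%:E =
   (m ^+ size J * \prod_(i <- J') fine (P (X i @^-1` B i)))%:E)%E.
Proof.
move=> mf f0 fm; elim: J J' B => [|i J IH] J' B /= uJ mB.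
  under eq_integral do rewrite big_nil mul1r prod_indic.
  rewrite integral_indic//; last first.
    by apply: bigcap_measurableType => // i _; exact: measurable_funPTI.
  by rewrite setIT expr0 mul1r; exact: indepX.
have mI j C : measurable C -> measurable_fun setT (fun w => \1_C (X j w) : R).
  by move=> mC; apply: (measurableT_comp (f := \1_C : T -> R)).
have m0 : 0 <= m.
  by rewrite -lee_fin -fm; apply: integral_ge0 => w _; rewrite lee_fin.
pose H w := \prod_(j <- J) f (X j w) * \prod_(j <- J') \1_(B j) (X j w).
pose c := m ^+ size J * \prod_(j <- J') fine (P (X j @^-1` B j)).
have iJ' : i \notin J' by move: uJ; rewrite mem_cat negb_or => /andP[/andP[]].
have hB C : measurable C ->
    (\int[P]_w (\1_C (X i w) * H w)%:E = c%:E * distribution P (X 0%N) C)%E.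
  (* The index i moves over to [J'] with the set [C]; since i is not in [J'], the sets of the other
     indices are unchanged. *)
  move=> mC; pose B' j := if j == i then C else B j.
  have B'J' (g : nat -> set T -> R) :
      \prod_(j <- J') g j (B' j) = \prod_(j <- J') g j (B j).
    apply: eq_big_seq => j jJ'; rewrite /B'; case: eqP => // ji.
    by rewrite -ji jJ' in iJ'.
  have := IH (i :: J') B'; rewrite uniq_catC /= => IH'.
  transitivity (\int[P]_w (\prod_(j <- J) f (X j w) *
      \prod_(j <- i :: J') \1_(B' j) (X j w))%:E)%E.
    apply: eq_integral => w _; congr (_%:E).
    rewrite big_cons (B'J' (fun j C => \1_C (X j w))) /B' eqxx /H.
    by rewrite mulrCA.
  rewrite IH'; last 2 first.
  - by move: uJ; rewrite uniq_catC mem_cat orbC -mem_cat.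
  - by move=> j; rewrite /B'; case: eqP.
  rewrite big_cons (B'J' (fun j C => fine (P (X j @^-1` C)))) {1}/B' eqxx /c.
  rewrite /distribution /pushforward (idX 0 i mC).
  have -> : P (X i @^-1` C) = (fine (P (X i @^-1` C)))%:E.
    by rewrite fineK// fin_num_measure//; exact: measurable_funPTI.
  by rewrite -EFinM /= -mulrA; congr (_ * _)%:E; exact: mulrC.
transitivity (\int[P]_w (f (X i w) * H w)%:E)%E.
  by apply: eq_integral => w _; rewrite big_cons /H mulrA.
rewrite (integral_weighted (nu := distribution P (X 0%N)) (c := c) (f := f))//.
- rewrite ge0_integral_distribution//; last by apply/measurable_EFinP.
  by rewrite fm -EFinM /c exprS mulrC mulrA.
- by apply: measurable_funM; apply: measurable_prod => j _; [exact: measurableT_comp|exact: mI].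
- by move=> w; rewrite mulr_ge0// prodr_ge0.
- by rewrite mulr_ge0 ?exprn_ge0// prodr_ge0// => j _; exact: fine_ge0.
Qed.

Lemma integral_iid_prod (f : T -> R) (m : R) (J : seq nat) :
  measurable_fun setT f -> (forall x, 0 <= f x) -> (\int[P]_w (f (X 0%N w))%:E = m%:E)%E ->
  uniq J -> (\int[P]_w (\prod_(i <- J) f (X i w))%:E = (m ^+ size J)%:E)%E.
Proof.
move=> mf f0 fm uJ.
have := @integral_iid_prod_indic f m J [::] (fun=> setT) mf f0 fm.
rewrite cats0 big_nil mulr1 => <- //.
by apply: eq_integral => w _; rewrite big_nil mulr1.
Qed.

End iid_product.

(** * Chernoff bound for truncated block sums *)

(** Inverting 1 - v <= exp(-v) gives exp(v) <= 1/(1 - v); the quadratic bound on the latter amounts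
    to v^2 (1 - 2v) >= 0. *)
Lemma expR_le_quadratic (R : realType) (v : R) : v <= 1 / 2 -> expR v <= 1 + v + 2 * v ^+ 2.
Proof.
move=> v2; have h := expR_ge1Dx (- v).
have v1 : 0 < 1 - v by lra.
have : expR v <= (1 - v)^-1.
  by rewrite -[leLHS]invrK -expRN lef_pV2 ?posrE ?expR_gt0.
move=> /le_trans; apply; rewrite -[leLHS]mul1r ler_pdivrMr//.
have : 0 <= v ^+ 2 * (1 - 2 * v) by rewrite mulr_ge0 ?sqr_ge0//; lra.
rewrite !expr2; nra.
Qed.

Section truncated_sums.
Context {dO : measure_display} {Omega : measurableType dO} {R : realType}.
Context (P : probability Omega R) (d : nat).
Local Notation V := 'rV[R]_d.+1.
Variable Z : nat -> {RV P >-> borel_rV R d}.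
Hypothesis indepZ : mutually_independent Z.
Hypothesis idZ : identically_distributed Z.
Hypothesis EZ0 : forall j, ('E_P[fun w => (Z 0%N w : V) 0%R j] = 0)%E.

Definition truncate (u : R) (x : V) : V := if enorm x <= u then x else 0.

Lemma truncate_coord u x j : truncate u x 0 j = x 0 j * \1_[set y | enorm y <= u] x.
Proof.
rewrite /truncate indicE; case: ifPn => h; first by rewrite mem_set// mulr1.
by rewrite memNset ?mulr0 ?mxE//; apply/negP.
Qed.

Lemma truncate_coord_le u x j : `|truncate u x 0 j| <= `|x 0 j|.
Proof. by rewrite /truncate; case: ifP => // _; rewrite mxE normr0. Qed.

Lemma truncate_coord_le_level u x j : 0 <= u -> `|truncate u x 0 j| <= u.
Proof.
move=> u0; rewrite /truncate; case: ifP => h; last by rewrite mxE normr0.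
exact: le_trans (coord_le_enorm x j) h.
Qed.

Lemma measurable_coord j : measurable_fun setT (fun x : borel_rV R d => (x : V) 0 j).
Proof. by apply: continuous_rV_measurable_realfun => x; exact: coord_continuous. Qed.

Lemma measurable_truncate_coord u j :
  measurable_fun setT (fun x : borel_rV R d => truncate u (x : V) 0 j).
Proof.
under eq_fun do rewrite truncate_coord.
apply: measurable_funM; first exact: measurable_coord.
apply: measurable_indic.
rewrite (_ : [set y : V | _] = ~` [set y | u < enorm y]).
  by apply: measurableC; apply: measurable_open_rV; exact: open_enorm_gt.
by apply/seteqP; split => y /=; rewrite leNgt => /negP.
Qed.

(** The difference of two infinite integrals is infinite by convention, so a mean equal to 0 forces
    the positive and negative parts to be integrable. *)
Lemma integrable_coord j : P.-integrable setT (fun w => ((Z 0%N w : V) 0 j)%:E).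
Proof.
have mZ : measurable_fun setT (fun w => (Z 0%N w : V) 0 j).
  by apply: (measurableT_comp (f := fun x : borel_rV R d => (x : V) 0 j)) => //; exact: measurable_coord.
apply/integrableP; split; first exact/measurable_EFinP.
rewrite integral_fin_num_abs//.
by have := EZ0 j; rewrite unlock => ->.
Qed.

Lemma integrable_truncate u j : P.-integrable setT (fun w => (truncate u (Z 0%N w) 0 j)%:E).
Proof.
apply: (le_integrable measurableT _ _ (integrable_coord j)).
  apply/measurable_EFinP.
  by apply: (measurableT_comp (f := fun x : borel_rV R d => truncate u (x : V) 0 j)) => //; exact: measurable_truncate_coord.
by move=> w _; rewrite lee_fin truncate_coord_le.
Qed.

Lemma integrable_abs_coord j : P.-integrable setT (fun w => (`|(Z 0%N w : V) 0 j|)%:E).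
Proof. exact: (integrable_norm (integrable_coord j)). Qed.

Definition truncated_mean (u : R) j : R := \int[P]_w (truncate u (Z 0%N w) 0 j).

Lemma truncated_mean_cvg0 j (e : R) : 0 < e ->
  exists K, forall k, (K <= k)%N -> `|truncated_mean k%:R j| <= e.
Proof.
move=> e0.
have [|||||_ _ h] := @dominated_convergence _ _ _ P setT measurableT
  (fun k w => (truncate k%:R (Z 0%N w) 0 j)%:E) (fun w => ((Z 0%N w : V) 0 j)%:E)
  (fun w => (`|(Z 0%N w : V) 0 j|)%:E).
- by move=> k; have /integrableP[] := integrable_truncate k%:R j.
- by have /integrableP[] := integrable_coord j.
- apply/nearW => w _; apply: cvg_near_cst; near=> k.
  rewrite /truncate ifT//; near: k; exact: nbhs_infty_ger.
- exact: integrable_abs_coord.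
- by apply/nearW => w k _; rewrite lee_fin truncate_coord_le.
have {h} : (fun k => (\int[P]_w (truncate k%:R (Z 0%N w) 0 j)%:E)%E) @ \oo --> 0%E.
  by have := EZ0 j; rewrite unlock => E0; rewrite -E0.
move=> /fine_cvgP[_] /cvgr0Pnorm_lt/(_ e e0)[K _ hK].
by exists K => k Kk; apply/ltW/hK.
Unshelve. all: by end_near. Qed.

Definition abs_mean j : R := \int[P]_w `|(Z 0%N w : V) 0 j|.

Lemma abs_mean_ge0 j : 0 <= abs_mean j.
Proof. exact: Rintegral_ge0. Qed.

(** The exponent v satisfies |v| <= theta, so its quadratic term is at most 2 theta |v|: a first
    moment bounds it, the variance being possibly infinite. The sign [s] serves both one-sided
    bounds. *)
Lemma truncated_mgf (s theta u : R) j : `|s| = 1 -> 0 < theta <= 1 / 2 -> 0 < u ->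
  exists m, [/\ (\int[P]_w (expR (theta / u * (s * truncate u (Z 0%N w) 0 j)))%:E = m%:E)%E,
    0 <= m & m <= expR (theta / u * (`|truncated_mean u j| + 2 * theta * abs_mean j))].
Proof.
move=> s1 /andP[t0 t1] u0.
pose v w := theta / u * (s * truncate u (Z 0%N w) 0 j).
have tu : 0 < theta / u by rewrite divr_gt0.
have mv : measurable_fun setT v.
  apply: measurable_funM => //; apply: measurable_funM => //.
  by apply: (measurableT_comp (f := fun x : borel_rV R d => truncate u (x : V) 0 j)) => //; exact: measurable_truncate_coord.
have v_abs w : `|v w| = theta / u * `|truncate u (Z 0%N w) 0 j|.
  by rewrite /v normrM (gtr0_norm tu) normrM s1 mul1r.
have v_le w : `|v w| <= theta.
  rewrite v_abs mulrAC ler_pdivrMr// ler_pM2l//.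
  by apply: truncate_coord_le_level; exact: ltW.
have v_half w : v w <= 1 / 2 by apply: le_trans (ler_norm _) (le_trans (v_le w) t1).
have mE : measurable_fun setT (fun w => expR (v w)).
  by apply: measurableT_comp => //; exact: measurable_expR.
have intE : P.-integrable setT (fun w => (expR (v w))%:E).
  apply: (@le_integrable _ _ _ P setT measurableT _ (EFin \o cst (expR (1 / 2)))).
  - exact/measurable_EFinP.
  - move=> w _; rewrite lee_fin ger0_norm ?expR_ge0// ger0_norm ?expR_ge0//.
    by rewrite ler_expR.
  - exact: finite_measure_integrable_cst.
have fin : (\int[P]_w (expR (v w))%:E)%E \is a fin_num by exact: integrable_fin_num.
exists (\int[P]_w (expR (v w))); split.
- by rewrite /Rintegral fineK.
- by apply: Rintegral_ge0 => w _; exact: expR_ge0.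
pose b w := 1 + (theta / u * s * truncate u (Z 0%N w) 0 j + 2 * theta * (theta / u) * `|(Z 0%N w : V) 0 j|).
have i1 : P.-integrable setT (EFin \o (fun w => theta / u * s * truncate u (Z 0%N w) 0 j)).
  apply: eq_integrable (integrableZl measurableT (theta / u * s) (integrable_truncate u j)) => //.
have i2 : P.-integrable setT (EFin \o (fun w => 2 * theta * (theta / u) * `|(Z 0%N w : V) 0 j|)).
  apply: eq_integrable (integrableZl measurableT (2 * theta * (theta / u)) (integrable_abs_coord j)) => //.
have i3 : P.-integrable setT (EFin \o (fun w => theta / u * s * truncate u (Z 0%N w) 0 j + 2 * theta * (theta / u) * `|(Z 0%N w : V) 0 j|)).
  exact: eq_integrable (integrableD measurableT i1 i2).
have i0 : P.-integrable setT (EFin \o cst (1 : R)) by exact: finite_measure_integrable_cst.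
have ib : P.-integrable setT (EFin \o b).
  exact: eq_integrable (integrableD measurableT i0 i3).
apply: (@le_trans _ _ (\int[P]_w b w)).
  apply: le_Rintegral => // w _; apply: (le_trans (expR_le_quadratic (v_half w))).
  rewrite /b -addrA lerD2l /v mulrA lerD2l.
  rewrite -mulrA -/(v w) -real_normK ?num_real// expr2.
  rewrite -!mulrA ler_pM2l//; apply: ler_pM => //.
  rewrite v_abs mulrA ler_pM2l//; exact: truncate_coord_le.
have -> : \int[P]_w b w = 1 + (theta / u * s * truncated_mean u j + 2 * theta * (theta / u) * abs_mean j).
  rewrite /b RintegralD// RintegralD// !RintegralZl//.
  + congr (_ + _); rewrite Rintegral_cst//.
    by have := @probability_setT _ _ _ P => /= ->; rewrite mulr1.
  + exact: integrable_abs_coord.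
  + exact: integrable_truncate.
apply: le_trans (expR_ge1Dx _); rewrite lerD2l mulrDr.
have -> : theta / u * (2 * theta * abs_mean j) = 2 * theta * (theta / u) * abs_mean j by ring.
rewrite lerD2r -mulrA ler_pM2l//; apply: (le_trans (ler_norm _)).
by rewrite normrM s1 mul1r.
Qed.

Lemma chernoff_truncated (s theta u x : R) j (J : seq nat) n :
  `|s| = 1 -> 0 < theta <= 1 / 2 -> 0 < u -> uniq J -> (size J <= n)%N ->
  pr P [set w | x < \sum_(l <- J) s * truncate u (Z l w) 0 j] <=
  expR (- (theta / u * (x - n%:R * (`|truncated_mean u j| + 2 * theta * abs_mean j)))).
Proof.
move=> s1 t01 u0 uJ Jn; have [m [hm m0 mle]] := truncated_mgf j s1 t01 u0.
have /andP[t0 t1] := t01; have tu : 0 < theta / u by rewrite divr_gt0.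
pose f (y : borel_rV R d) := expR (theta / u * (s * truncate u (y : V) 0 j)).
have mf : measurable_fun setT f.
  apply: measurableT_comp; first exact: measurable_expR.
  apply: measurable_funM => //; apply: measurable_funM => //.
  exact: measurable_truncate_coord.
have f0 y : 0 <= f y by exact: expR_ge0.
have hJ := integral_iid_prod indepZ idZ mf f0 hm uJ.
have mS : measurable_fun setT (fun w => \sum_(l <- J) s * truncate u (Z l w) 0 j).
  apply: measurable_sum => l; apply: measurable_funM => //.
  by apply: (measurableT_comp (f := fun x : borel_rV R d => truncate u (x : V) 0 j)) => //; exact: measurable_truncate_coord.
have mA : measurable [set w | x < \sum_(l <- J) s * truncate u (Z l w) 0 j].
  have := mS measurableT `]x, +oo[%classic (measurable_itv _); rewrite setTI.
  by congr measurable; apply/seteqP; split => w /=; rewrite in_itv/= andbT.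
have mprod : measurable_fun setT (fun w => \prod_(l <- J) f (Z l w)).
  by apply: measurable_prod => l _; exact: measurableT_comp.
have step : pr P [set w | x < \sum_(l <- J) s * truncate u (Z l w) 0 j] <=
    expR (- (theta / u * x)) * m ^+ size J.
  rewrite -lee_fin prE// EFinM -hJ -ge0_integralZl_EFin ?expR_ge0//; last 2 first.
  - by move=> w _; rewrite lee_fin prodr_ge0.
  - exact/measurable_EFinP.
  rewrite -[X in P X]setIT -integral_indic//.
  apply: ge0_le_integral => //.
  - by apply/measurable_EFinP; exact: measurable_indic.
  - by apply/measurable_EFinP; apply: measurable_funM.
  - move=> w _; rewrite -EFinM lee_fin indicE.
    have [/set_mem /= xw|_] := boolP (w \in _); last by rewrite mulr_ge0 ?expR_ge0 ?prodr_ge0.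
    rewrite -expR_sum -expRD -[leLHS]expR0 ler_expR -mulr_sumr.
    by rewrite addrC subr_ge0 ler_pM2l// ltW.
apply: (le_trans step).
have -> : - (theta / u * (x - n%:R * (`|truncated_mean u j| + 2 * theta * abs_mean j))) =
  - (theta / u * x) + n%:R * (theta / u * (`|truncated_mean u j| + 2 * theta * abs_mean j)) by ring.
rewrite expRD ler_pM2l ?expR_gt0// expRM_natl.
apply: (@le_trans _ _ (expR (theta / u * (`|truncated_mean u j| + 2 * theta * abs_mean j)) ^+ size J)).
  by apply: lerXn2r; rewrite ?nnegrE ?expR_ge0.
(* The base is at least 1, so the power may be raised from the block length to n, which makes the
   bound uniform over blocks. *)
apply: ler_weXn2l => //; rewrite -[leLHS]expR0 ler_expR.
by rewrite mulr_ge0 ?(ltW tu)// addr_ge0// !mulr_ge0// ?abs_mean_ge0 ?ltW.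
Qed.

End truncated_sums.

(** * The bad event *)

Section bad_event.
Context {dO : measure_display} {Omega : measurableType dO} {R : realType}.
Context (P : probability Omega R) (d : nat).
Local Notation V := 'rV[R]_d.+1.
Variable Z : nat -> {RV P >-> borel_rV R d}.
Hypothesis indepZ : mutually_independent Z.
Hypothesis idZ : identically_distributed Z.

Lemma pr_bigU_uniform (I : eqType) (s : seq I) (E : I -> set Omega) (c : R) :
  (forall i, measurable (E i)) -> (forall i, i \in s -> pr P (E i) <= c) ->
  pr P (\big[setU/set0]_(i <- s) E i) <= (size s)%:R * c.
Proof.
move=> mE Ec; apply: (le_trans (pr_bigU_le P s mE)).
apply: (@le_trans _ _ (\sum_(i <- s) c)).
  by rewrite big_seq [leRHS]big_seq; apply: ler_sum => i; exact: Ec.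
by rewrite big_const_seq count_predT iter_addr_0 mulr_natl.
Qed.

Lemma in_bigU (I : eqType) (s : seq I) (E : I -> set Omega) (i : I) w :
  i \in s -> E i w -> (\big[setU/set0]_(j <- s) E j) w.
Proof.
move=> + Ew; elim: s => // j s IH; rewrite inE big_cons => /orP[/eqP <-|is_]; first by left.
by right; exact: IH.
Qed.

Definition jump (u : R) (l : nat) : set Omega := [set w | u < enorm (Z l w : V)].

Lemma measurable_jump u l : measurable (jump u l).
Proof. exact: measurable_enorm_gt. Qed.

Lemma tail_id l u : tail (Z l) u = tail (Z 0%N) u.
Proof.
have mH : measurable ([set x | u < enorm x] : set (borel_rV R d)).
  by apply: measurable_open_rV; exact: open_enorm_gt.
by rewrite !tailE /pr; have := idZ l 0 mH; rewrite /preimage /= => ->.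
Qed.

Lemma pr_jumps u (J : seq nat) : uniq J ->
  pr P (\bigcap_(l in [set` J]) jump u l) = tail (Z 0%N) u ^+ size J.
Proof.
move=> uJ; have mH : measurable ([set x | u < enorm x] : set (borel_rV R d)).
  by apply: measurable_open_rV; exact: open_enorm_gt.
rewrite /pr (indepZ (B := fun=> [set x | u < enorm x]) uJ (fun=> mH)) /=.
rewrite (eq_bigr (fun=> tail (Z 0%N) u)); last by move=> l _; rewrite -(tail_id l).
by rewrite big_const_seq count_predT iter_mulr_1.
Qed.

Definition two_jumps (n : nat) (v : R) : set Omega :=
  \big[setU/set0]_(p <- [seq (i, j) | i <- iota 1 n, j <- iota 1 n])
    (if p.1 == p.2 then set0 else jump v p.1 `&` jump v p.2).

(** The tuples also use the index 0, for the sake of the finite type of tuples of ordinals; this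
    only turns n^L into (n+1)^L in the union bound. *)
Definition many_jumps (n : nat) (u : R) (L : nat) : set Omega :=
  \big[setU/set0]_(t <- enum {: L.-tuple 'I_n.+1})
    (if uniq t then \bigcap_(l in [set` [seq val i | i <- t]]) jump u l else set0).

(* p = (i, k, j, sign) stands for the j-th coordinate of the block
   Z_{i+1}, ..., Z_{i+k}. *)
Definition large_block (n : nat) (x u : R) : set Omega :=
  \big[setU/set0]_(p <- enum {: 'I_n.+1 * 'I_n.+1 * 'I_d.+1 * bool})
    [set w | x < \sum_(l <- iota p.1.1.1.+1 p.1.1.2) (-1) ^+ p.2 * truncate u (Z l w) 0 p.1.2].

Lemma measurable_two_jumps n v : measurable (two_jumps n v).
Proof.
apply: bigsetU_measurable => p _; case: ifP => // _.
by apply: measurableI; exact: measurable_jump.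
Qed.

Lemma measurable_many_jumps n u L : measurable (many_jumps n u L).
Proof.
apply: bigsetU_measurable => t _; case: ifP => // _.
by apply: bigcap_measurableType => // l _; exact: measurable_jump.
Qed.

Lemma measurable_block_sum (x s u : R) j (J : seq nat) :
  measurable [set w | x < \sum_(l <- J) s * truncate u (Z l w) 0 j].
Proof.
have mS : measurable_fun setT (fun w => \sum_(l <- J) s * truncate u (Z l w) 0 j).
  apply: measurable_sum => l; apply: measurable_funM => //.
  by apply: (measurableT_comp (f := fun x : borel_rV R d => truncate u (x : V) 0 j)) => //; exact: measurable_truncate_coord.
have := mS measurableT `]x, +oo[%classic (measurable_itv _); rewrite setTI.
by congr measurable; apply/seteqP; split => w /=; rewrite in_itv/= andbT.
Qed.

Lemma measurable_large_block n x u : measurable (large_block n x u).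
Proof. by apply: bigsetU_measurable => p _; exact: measurable_block_sum. Qed.

Lemma pr_two_jumps n v : pr P (two_jumps n v) <= (n%:R * tail (Z 0%N) v) ^+ 2.
Proof.
have := @pr_bigU_uniform _ [seq (i, j) | i <- iota 1 n, j <- iota 1 n]
  (fun p => if p.1 == p.2 then set0 else jump v p.1 `&` jump v p.2) (tail (Z 0%N) v ^+ 2).
rewrite size_allpairs !size_iota natrM -expr2 -exprMn; apply.
  move=> p; case: ifP => // _.
  by apply: measurableI; exact: measurable_jump.
move=> [i j] _ /=; case: eqP => ij; first by rewrite /pr measure0 sqr_ge0.
have uij : uniq [:: i; j] by rewrite /= inE andbT; apply/eqP.
rewrite -(pr_jumps v uij) (_ : \bigcap_(l in _) _ = jump v i `&` jump v j)//.
apply/seteqP; split => w.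
  by move=> h; split; apply: h; rewrite /= !inE eqxx ?orbT.
by move=> [wi wj] l; rewrite /= !inE => /orP[] /eqP ->.
Qed.

Lemma pr_many_jumps n u L : pr P (many_jumps n u L) <= (n.+1%:R * tail (Z 0%N) u) ^+ L.
Proof.
have := @pr_bigU_uniform _ (enum {: L.-tuple 'I_n.+1})
  (fun t : L.-tuple 'I_n.+1 => if uniq t then \bigcap_(l in [set` [seq val i | i <- t]]) jump u l else set0)
  (tail (Z 0%N) u ^+ L).
rewrite -cardE card_tuple card_ord natrX -exprMn; apply.
  move=> t; case: ifP => // _.
  by apply: bigcap_measurableType => // l _; exact: measurable_jump.
move=> t _; case: ifP => ut; last by rewrite /pr measure0 exprn_ge0// tail_ge0.
rewrite pr_jumps; first by rewrite size_map size_tuple.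
by rewrite map_inj_uniq//; exact: val_inj.
Qed.

(** * Block sums off the bad event *)

Section outside_bad.
Variables (n L : nat) (eps eta u : R) (w : Omega).
Hypothesis eps_ge0 : 0 <= eps.
Hypothesis u_ge0 : 0 <= u.
Hypothesis u_le : u <= eps * n%:R.
Hypothesis Leps : L%:R * eps <= eta / 2.
Hypothesis not_two : ~ two_jumps n (eps * n%:R) w.
Hypothesis not_many : ~ many_jumps n u L w.
Hypothesis not_block : ~ large_block n (eta / 2 * n%:R) u w.

Lemma single_jump i j : (0 < i <= n)%N -> (0 < j <= n)%N ->
  jump (eps * n%:R) i w -> jump (eps * n%:R) j w -> i = j.
Proof.
move=> /andP[i0 iN] /andP[j0 jN] wi wj; apply: contrapT => /eqP ij; apply: not_two.
apply: (@in_bigU _ _ _ (i, j)); last by rewrite /= (negbTE ij).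
by apply/allpairsP; exists (i, j); split; rewrite // mem_iota add1n ltnS ?i0 ?j0.
Qed.

Lemma few_jumps (s : seq nat) : uniq s -> {subset s <= iota 1 n} ->
  (count (fun l => u < enorm (Z l w : V))%R s <= L)%N.
Proof.
move=> us sn; rewrite leqNgt; apply/negP => Lc; apply: not_many.
pose r := take L [seq l <- s | u < enorm (Z l w : V)].
have szr : size r = L by rewrite size_takel// size_filter ltnW.
have rP l : l \in r -> (0 < l <= n)%N /\ jump u l w.
  move=> /mem_take; rewrite mem_filter => /andP[ul /sn].
  by rewrite mem_iota add1n ltnS => ln; split.
have ur : uniq r by rewrite take_uniq// filter_uniq.
have szt : size [seq inord l : 'I_n.+1 | l <- r] == L by rewrite size_map szr.
have valt : [seq val i | i <- Tuple szt] = r.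
  by rewrite /= -map_comp map_id_in// => l /rP[/andP[_ ln] _] /=; rewrite inordK.
apply: (@in_bigU _ _ _ (Tuple szt)); first by rewrite mem_enum.
rewrite ifT; last by rewrite -(map_inj_uniq val_inj) valt.
by rewrite valt => l /= /rP[].
Qed.

(* At most L terms exceed u, and they add up to at most L eps n <= eta n / 2; the
   other terms form a block truncated at u. *)
Lemma truncated_block_le i k : (i + k <= n)%N ->
  `|\sum_(l <- iota i.+1 k) truncate (eps * n%:R) (Z l w)| <= eta * n%:R.
Proof.
move=> ikn.
have e0 : 0 <= eta / 2 by apply: le_trans Leps; rewrite mulr_ge0.
apply: norm_rV_le => [|j]; first by rewrite mulr_ge0//; lra.
rewrite summxE.
pose T v l := truncate v (Z l w) 0 j.
have -> : \sum_(l <- iota i.+1 k) truncate (eps * n%:R) (Z l w) 0 j =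
    \sum_(l <- iota i.+1 k) T u l + \sum_(l <- iota i.+1 k) (T (eps * n%:R) l - T u l).
  by rewrite -big_split /=; apply: eq_bigr => l _; rewrite addrC subrK.
apply: (le_trans (ler_normD _ _)).
have -> : eta * n%:R = eta / 2 * n%:R + eta / 2 * n%:R by lra.
apply: lerD.
  have blk (b : bool) : \sum_(l <- iota i.+1 k) (-1) ^+ b * T u l <= eta / 2 * n%:R.
    rewrite leNgt; apply/negP => h; apply: not_block.
    have iN : (i < n.+1)%N by rewrite ltnS (leq_trans _ ikn)// leq_addr.
    have kN : (k < n.+1)%N by rewrite ltnS (leq_trans _ ikn)// leq_addl.
    by apply: (@in_bigU _ _ _ (Ordinal iN, Ordinal kN, j, b)); first by rewrite mem_enum.
  rewrite ler_norml; apply/andP; split; last first.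
    by have := blk false; under eq_bigr do rewrite expr0 mul1r.
  have := blk true; under eq_bigr do rewrite expr1 mulN1r.
  by rewrite sumrN lerNl.
apply: (le_trans (ler_norm_sum _ _ _)).
apply: (@le_trans _ _ (\sum_(l <- iota i.+1 k | u < enorm (Z l w : V)) eps * n%:R)).
  rewrite [leRHS]big_mkcond; apply: ler_sum => l _.
  case: ifPn => [ul|]; last first.
    rewrite -leNgt => lu; rewrite /T /truncate lu (le_trans lu u_le).
    by rewrite subrr normr0.
  have -> : T u l = 0 by rewrite /T /truncate leNgt ul mxE.
  rewrite subr0.
  by apply: truncate_coord_le_level; rewrite mulr_ge0.
rewrite big_const_seq iter_addr_0 -[leLHS]mulr_natl mulrA ler_wpM2r//.
apply: le_trans Leps; rewrite ler_wpM2r// ler_nat.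
apply: few_jumps; first exact: iota_uniq.
move=> l; rewrite !mem_iota; lia.
Qed.

Lemma block_no_jump i k : (i + k <= n)%N ->
  (forall l, (i < l <= i + k)%N -> ~ jump (eps * n%:R) l w) ->
  `|\sum_(l <- iota i.+1 k) (Z l w : V)| <= eta * n%:R.
Proof.
move=> ikn nj; have := truncated_block_le ikn.
rewrite (_ : \sum_(l <- _) truncate _ _ = \sum_(l <- iota i.+1 k) (Z l w : V))//.
apply: eq_big_seq => l; rewrite mem_iota => lik.
rewrite /truncate ifT// leNgt; apply/negP; apply: nj; move: lik; lia.
Qed.

(** Off [two_jumps], truncation at eps n removes the term j from the block and nothing else. *)
Lemma block_jump i k j : (i + k <= n)%N -> (i < j <= i + k)%N ->
  jump (eps * n%:R) j w ->
  `|\sum_(l <- iota i.+1 k) (Z l w : V) - (Z j w : V)| <= eta * n%:R.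
Proof.
move=> ikn jik wj; have := truncated_block_le ikn.
have jin : j \in iota i.+1 k by rewrite mem_iota; move: jik; lia.
rewrite (_ : \sum_(l <- iota i.+1 k) (Z l w : V) - (Z j w : V) =
  \sum_(l <- iota i.+1 k) truncate (eps * n%:R) (Z l w))//.
rewrite (bigD1_seq j) ?iota_uniq//= [in RHS](bigD1_seq j) ?iota_uniq//=.
have -> : truncate (eps * n%:R) (Z j w) = 0.
  by rewrite /truncate leNgt; move: wj; rewrite /jump /= => ->.
rewrite addrAC subrr !add0r.
rewrite big_seq_cond [RHS]big_seq_cond; apply: eq_bigr => l /andP[].
rewrite mem_iota => lik lj; rewrite /truncate ifT// leNgt; apply/negP => wl.
move/eqP: lj; apply; apply: single_jump => //; move: lik jik; lia.
Qed.

End outside_bad.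

Definition bad_event (n L : nat) (eps eta u : R) : set Omega :=
  two_jumps n (eps * n%:R) `|` (many_jumps n u L `|` large_block n (eta / 2 * n%:R) u).

Lemma measurable_bad_event n L eps eta u : measurable (bad_event n L eps eta u).
Proof.
apply: measurableU; first exact: measurable_two_jumps.
by apply: measurableU; [exact: measurable_many_jumps|exact: measurable_large_block].
Qed.

(** * Probability of the bad event *)

Variables (alpha : R) (mu : {measure set borel_ext R d -> \bar R}).
Hypothesis alpha_gt1 : 1 < alpha.
Hypothesis rvZ : regularly_varying (Z 0%N) alpha mu.
Hypothesis EZ0 : forall j, ('E_P[fun w => (Z 0%N w : V) 0%R j] = 0)%E.

Let alpha_gt0 : 0 < alpha. Proof. exact: lt_trans alpha_gt1. Qed.

Let f n := tail (Z 0%N) n%:R.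

Lemma tail_truncation_level : exists L (u : nat -> nat),
  [/\ [/\ (forall n, 0 < u n)%N, (forall K, \forall n \near \oo, (K <= u n)%N) &
       forall e : R, 0 < e -> \forall n \near \oo, (u n)%:R <= e * n%:R],
      (forall e : R, 0 < e -> \forall n \near \oo, n%:R * f n <= e),
      (forall e : R, 0 < e -> \forall n \near \oo, (n%:R * f (u n)) ^+ L <= e * (n%:R * f n)) &
      (forall theta e : R, 0 < theta -> 0 < e -> \forall n \near \oo,
        n%:R ^+ 2 * expR (- (theta * (n%:R / (u n)%:R))) <= e * (n%:R * f n))].
Proof.
pose r : R := 2 `^ (- alpha).
have r0 : 0 < r by exact: powR_gt0.
have r2 : r < 1 / 2.
  rewrite /r powRN div1r ltf_pV2 ?posrE ?powR_gt0//.
  rewrite -(@mulr_powRB1 _ 2 alpha)// -[ltLHS]mulr1 ltr_pM2l//.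
  have := @gt0_ltr_powR R (alpha - 1) _ 1 2; rewrite !nnegrE powR1; apply => //.
  + by rewrite subr_gt0.
  + exact: ltr1n.
(* The limit 2^-alpha of the doubling ratio is below 1/2 because alpha > 1. Half of it, and the
   midpoint between it and 1/2, are strict bounds on either side with 2 rho < 1. *)
apply: (@truncation_level R f (r / 2) ((r + 1 / 2) / 2)).
- by move=> n; exact: tail_gt0 rvZ _.
- by move=> m n mn; apply: tail_anti; rewrite ler_nat.
- by apply/andP; split; lra.
- lra.
- lra.
have h1 : \forall n \near \oo, (r - r / 2) * f n <= tail (Z 0%N) (2 * n%:R).
  by apply: (tail_integer_ge rvZ) => //; lra.
have h2 : \forall n \near \oo, tail (Z 0%N) (2 * n%:R) <= (r + (1 / 2 - r) / 2) * f n.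
  by apply: (tail_integer_le rvZ) => //; lra.
near=> n; apply/andP; split.
  have -> : r / 2 = r - r / 2 by lra.
  rewrite /f natrM; near: n; exact: h1.
have -> : (r + 1 / 2) / 2 = r + (1 / 2 - r) / 2 by lra.
rewrite /f natrM; near: n; exact: h2.
Unshelve. all: by end_near. Qed.

(** The hypothesis on the means consumes eta n / 4 of the threshold eta n / 2; the other half drives
    the exponent. There are 2 (d+1) (n+1)^2 choices of sign, coordinate and block, at most 8 (d+1)
    n^2. *)
Lemma pr_large_block_le (eta theta u : R) n : 0 < theta <= 1 / 2 -> 0 < u -> 0 < eta ->
  (0 < n)%N ->
  (forall j, `|truncated_mean Z u j| + 2 * theta * abs_mean Z j <= eta / 4) ->
  pr P (large_block n (eta / 2 * n%:R) u) <=
    (8 * d.+1%:R) * (n%:R ^+ 2 * expR (- (theta * eta / 4 * (n%:R / u)))).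
Proof.
move=> t01 u0 eta0 n0 hb; have /andP[t0 t1] := t01.
have := @pr_bigU_uniform _ (enum {: 'I_n.+1 * 'I_n.+1 * 'I_d.+1 * bool})
  (fun p => [set w | eta / 2 * n%:R < \sum_(l <- iota p.1.1.1.+1 p.1.1.2) (-1) ^+ p.2 * truncate u (Z l w) 0 p.1.2])
  (expR (- (theta * eta / 4 * (n%:R / u)))).
rewrite -cardE !card_prod !card_ord card_bool => h.
apply: (le_trans (h _ _)).
- by move=> p; exact: measurable_block_sum.
- move=> [[[i k] j] b'] _ /=.
  apply: (le_trans (chernoff_truncated indepZ idZ EZ0 _ j _ t01 u0 (iota_uniq _ _) _)).
  + by rewrite normrX normrN1 expr1n.
  + by rewrite size_iota; apply: (ltn_ord k).
  rewrite ler_expR lerN2.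
  have -> : theta * eta / 4 * (n%:R / u) = theta / u * (eta / 4 * n%:R) by field; exact: lt0r_neq0.
  rewrite ler_pM2l ?divr_gt0//.
  have : n%:R * (`|truncated_mean Z u j| + 2 * theta * abs_mean Z j) <= n%:R * (eta / 4).
    by rewrite ler_wpM2l.
  have -> : eta / 2 * n%:R = eta / 4 * n%:R + n%:R * (eta / 4) by lra.
  lra.
rewrite mulrA ler_pM2r ?expR_gt0// !natrM.
have n1 : (1 : R) <= n%:R by rewrite ler1n.
have d1 : (1 : R) <= d.+1%:R by rewrite ler1n.
have : (n.+1%:R : R) * n.+1%:R <= (2 * n%:R) * (2 * n%:R).
  by apply: ler_pM => //; rewrite -natr1; lra.
rewrite expr2; nra.
Qed.

(** The bound on the squared tail is stated separately because it also controls the error term of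
    Bonferroni's inequality. *)
Lemma pr_bad_event (eta eps0 : R) : 0 < eta -> 0 < eps0 -> exists L (u : nat -> nat) eps,
  [/\ 0 < eps <= eps0 /\ L%:R * eps <= eta / 2,
    (\forall n \near \oo, (u n)%:R <= eps * n%:R),
    (forall e : R, 0 < e -> \forall n \near \oo,
      (n%:R * tail (Z 0%N) (eps * n%:R)) ^+ 2 <= e * (n%:R * f n)) &
    forall e : R, 0 < e -> \forall n \near \oo,
      pr P (bad_event n L eps eta (u n)%:R) <= e * (n%:R * f n)].
Proof.
move=> eta0 eps00.
have [L [u [[u0 uoo ule] nf many block]]] := tail_truncation_level.
(* L comes from the tail alone, so eps may depend on it; dividing by L+1 covers L = 0. *)
pose eps := Num.min eps0 (eta / 2 / L.+1%:R).
have eps_gt0 : 0 < eps by rewrite lt_min eps00 !divr_gt0.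
have epsL : L%:R * eps <= eta / 2.
  apply: (@le_trans _ _ (L.+1%:R * (eta / 2 / L.+1%:R))).
    by apply: ler_pM => //; [exact: ltW|rewrite ler_nat|rewrite ge_min lexx orbT].
  by rewrite mulrCA mulfV// mulr1.
have two (e : R) : 0 < e -> \forall n \near \oo,
    (n%:R * tail (Z 0%N) (eps * n%:R)) ^+ 2 <= e * (n%:R * f n).
  move=> e0; pose C := eps `^ (- alpha) + 1.
  have C0 : 0 < C by rewrite addr_gt0// powR_gt0.
  have C2 : 0 < C ^+ 2 by rewrite exprn_gt0.
  near=> n.
  have h1 : tail (Z 0%N) (eps * n%:R) <= C * f n.
    by near: n; exact: (tail_integer_le rvZ eps_gt0 ltr01).
  have h2 : n%:R * f n <= e / C ^+ 2 by near: n; apply: nf; rewrite divr_gt0.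
  have nf0 : 0 <= n%:R * f n by rewrite mulr_ge0// tail_ge0.
  apply: (@le_trans _ _ ((C * (n%:R * f n)) ^+ 2)).
    apply: lerXn2r; rewrite ?nnegrE.
    - by rewrite mulr_ge0// tail_ge0.
    - by rewrite mulr_ge0// ltW.
    - by rewrite mulrCA ler_wpM2l.
  rewrite exprMn [X in _ * X]expr2 mulrA ler_wpM2r//.
  by move: h2; rewrite ler_pdivlMr// mulrC.
exists L, u, eps; split => //.
- by split; rewrite // eps_gt0 ge_min lexx.
- exact: ule.
move=> e e0; have e3 : 0 < e / 3 by lra.
pose K := \sum_j abs_mean Z j.
have K0 : 0 <= K by apply: sumr_ge0 => j _; exact: abs_mean_ge0.
have Kj j : abs_mean Z j <= K.
  rewrite /K (bigD1 j)//= lerDl; apply: sumr_ge0 => l _; exact: abs_mean_ge0.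
(* This makes 2 theta E|Z_j| at most eta / 8 in every coordinate; another eta / 8 is granted to the
   truncated means, which vanish as u tends to infinity. *)
pose theta := Num.min (1 / 2) (eta / (16 * (K + 1))).
have K1 : 0 < 16 * (K + 1) by lra.
have t0 : 0 < theta by rewrite lt_min; apply/andP; split; [lra|rewrite divr_gt0].
have t1 : theta <= 1 / 2 by rewrite ge_min lexx.
have tK j : 2 * theta * abs_mean Z j <= eta / 8.
  have h : theta * (16 * (K + 1)) <= eta.
    by rewrite -ler_pdivlMr// ge_min lexx orbT.
  have : theta * abs_mean Z j <= theta * K by rewrite ler_pM2l.
  nra.
have eta8 : 0 < eta / 8 by lra.
have [Kf hKf] := choice (fun j => truncated_mean_cvg0 EZ0 j eta8).
have d8 : (0 : R) < 8 * d.+1%:R by rewrite mulr_gt0.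
have te : 0 < theta * eta / 4 by rewrite !mulr_gt0.
near=> n.
have n0 : (0 < n)%N by near: n; exact: nbhs_infty_gt.
have un : (\max_j Kf j <= u n)%N by near: n; exact: uoo.
have h1 : (n%:R * tail (Z 0%N) (eps * n%:R)) ^+ 2 <= e / 3 * (n%:R * f n).
  by near: n; exact: two.
have h2 : (n%:R * f (u n)) ^+ L <= e / 3 / 2 ^+ L * (n%:R * f n).
  by near: n; apply: many; rewrite divr_gt0// exprn_gt0.
have h3 : n%:R ^+ 2 * expR (- (theta * eta / 4 * (n%:R / (u n)%:R))) <=
    e / 3 / (8 * d.+1%:R) * (n%:R * f n).
  by near: n; apply: block => //; rewrite divr_gt0.
have b1 : pr P (two_jumps n (eps * n%:R)) <= e / 3 * (n%:R * f n).
  exact: le_trans (pr_two_jumps _ _) h1.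
have b2 : pr P (many_jumps n (u n)%:R L) <= e / 3 * (n%:R * f n).
  apply: (le_trans (pr_many_jumps _ _ _)).
  apply: (@le_trans _ _ (2 ^+ L * (n%:R * f (u n)) ^+ L)).
    rewrite -exprMn; apply: lerXn2r; rewrite ?nnegrE ?mulr_ge0 ?tail_ge0//.
    rewrite mulrA ler_wpM2r ?tail_ge0// -natrM ler_nat mul2n -addnn.
    by rewrite -addn1 leq_add2l.
  by move: h2; rewrite mulrAC ler_pdivlMr ?exprn_gt0// mulrC.
have b3 : pr P (large_block n (eta / 2 * n%:R) (u n)%:R) <= e / 3 * (n%:R * f n).
  apply: (@le_trans _ _ (8 * d.+1%:R * (n%:R ^+ 2 * expR (- (theta * eta / 4 * (n%:R / (u n)%:R)))))).
    apply: pr_large_block_le => //; first by rewrite t0.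
      by rewrite ltr0n.
    move=> j; have := tK j; have := hKf j (u n) (leq_trans (leq_bigmax j) un).
    lra.
  rewrite (_ : e / 3 * (n%:R * f n) =
    8 * d.+1%:R * (e / 3 / (8 * d.+1%:R) * (n%:R * f n))); first by rewrite ler_pM2l.
  by rewrite [RHS]mulrA [8 * d.+1%:R * _]mulrC divfK// gt_eqF.
apply: (le_trans (prU_le P (measurable_two_jumps _ _) _)).
  by apply: measurableU; [exact: measurable_many_jumps|exact: measurable_large_block].
have := prU_le P (measurable_many_jumps n (u n)%:R L) (measurable_large_block n (eta / 2 * n%:R) (u n)%:R).
lra.
Unshelve. all: by end_near. Qed.

End bad_event.

(** * The stretch event *)

Lemma limn_esup_le (R : realType) (x : nat -> R) (c : R) :
  (forall e, 0 < e -> \forall n \near \oo, x n <= c + e) ->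
  (limn_esup (fun n => (x n)%:E) <= c%:E)%E.
Proof.
move=> h; apply/lee_addgt0Pr => e e0.
have hA : \oo [set n | x n <= c + e] by exact: h.
apply: (@le_trans _ _ (ereal_sup [set (x n)%:E | n in [set n | x n <= c + e]])).
  by apply: ereal_inf_lbound; exists [set n | x n <= c + e].
by apply: ge_ereal_sup => _ [n /= xn <-]; rewrite -EFinD lee_fin.
Qed.

Lemma le_limn_einf (R : realType) (x : nat -> R) (c : R) :
  (forall e, 0 < e -> \forall n \near \oo, c - e <= x n) ->
  (c%:E <= limn_einf (fun n => (x n)%:E))%E.
Proof.
move=> h; rewrite /limn_einf leeNr -EFinN.
have -> : (\- (fun n => (x n)%:E))%E = (fun n => (- x n)%:E) by apply/funext.
apply: limn_esup_le => e e0; apply: filterS (h e e0) => n.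
by rewrite lerBlDr => xn; lra.
Qed.

(** * Measurability of vector-valued maps *)

Section measurable_vectors.
Context {dO : measure_display} {Omega : measurableType dO} {R : realType} (d : nat).
Local Notation V := 'rV[R]_d.+1.

Lemma measurable_ball_coord (f : Omega -> V) (q : V) (r : R) : 0 < r ->
  (forall j, measurable_fun setT (fun w => f w 0 j)) ->
  measurable [set w | ball q r (f w)].
Proof.
move=> r0 mf.
have -> : [set w | ball q r (f w)] =
    \bigcap_(j in [set: 'I_d.+1]) [set w | `|q 0 j - f w 0 j| < r].
  apply/seteqP; split => w /=; first by move=> [_ h] j _; exact: h.
  by move=> h; split => // i j; rewrite (ord1 i); exact: h.
apply: fin_bigcap_measurable => // j _.
have mg : measurable_fun setT (fun w => `|q 0 j - f w 0 j|).
  by apply: measurableT_comp => //; apply: measurable_funB.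
have := mg measurableT `]-oo, r[%classic (measurable_itv _); rewrite setTI.
by congr measurable; apply/seteqP; split => w /=; rewrite in_itv.
Qed.

Lemma rat_approx (x : V) (r : R) : 0 < r ->
  exists q : 'rV[rat]_d.+1, ball (map_mx ratr q : V) r x.
Proof.
move=> r0.
have /choice[q hq] : forall j, exists q : rat, `|ratr q - x 0 j| < r.
  move=> j; have [|q] := @rat_in_itvoo R (x 0 j - r) (x 0 j + r); first by lra.
  rewrite in_itv /= => /andP[q1 q2].
  by exists q; rewrite ltr_norml; apply/andP; split; lra.
exists (\row_j q j); split => // i j.
by rewrite (ord1 i) !mxE; exact: hq.
Qed.

Lemma open_rV_bigcup (G : set V) : open G ->
  G = \bigcup_(p in [set p : 'rV[rat]_d.+1 * nat |
    ball (map_mx ratr p.1 : V) p.2.+1%:R^-1 `<=` G]) ball (map_mx ratr p.1 : V) p.2.+1%:R^-1.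
Proof.
move=> oG; apply/seteqP; split => x; last by move=> [p /= pG px]; exact: pG.
move=> Gx; have /nbhs_ballP[r /= r0 rG] : nbhs x G by exact: open_nbhs_nbhs.
have r2 : 0 < r / 2 by rewrite divr_gt0.
have [k] := ltr_add_invr r2; rewrite add0r => kr.
have k0 : (0 : R) < k.+1%:R^-1 by rewrite invr_gt0.
have [q hq] := rat_approx x k0.
exists (q, k) => //= y qy; apply: rG.
apply: le_ball (ball_triangle (ball_sym hq) qy).
by rewrite [leRHS]splitr lerD// ltW.
Qed.

(** The Borel sets are generated by the open sets, not coordinatewise: an open set is a countable
    union of balls with rational centres, and a ball of the sup norm is a finite intersection of
    conditions on coordinates. *)
Lemma measurable_fun_rV (f : Omega -> V) :
  (forall j, measurable_fun setT (fun w => f w 0 j)) ->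
  measurable_fun setT (f : Omega -> borel_rV R d).
Proof.
move=> mf; apply: (@measurability _ _ Omega (borel_rV R d) setT f (@open V)) => // _ [G oG <-].
rewrite setTI (open_rV_bigcup oG) preimage_bigcup bigcup_mkcond.
apply: countable_bigcupT_measurable => [|p]; first exact: countableP.
by case: ifP => // _; apply: measurable_ball_coord.
Qed.

End measurable_vectors.

Section stretch_event.
Context {dO : measure_display} {Omega : measurableType dO} {R : realType}.
Context (P : probability Omega R) (d : nat).
Local Notation V := 'rV[R]_d.+1.
Variable Z : nat -> {RV P >-> borel_rV R d}.
Implicit Types (A : set V) (n i k : nat) (t : R).

Lemma walk_block i k w :
  walk Z (i + k) w - walk Z i w = \sum_(l <- iota i.+1 k) (Z l w : V).
Proof.
rewrite /walk (@big_cat_nat _ _ _ i.+1 1 (i + k).+1)//=; last by rewrite ltnS leq_addr.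
by rewrite addrAC subrr add0r /index_iota subSS addKn.
Qed.

(** For k > 0 this says that the block increment lies in kA, in the form of a preimage of [A], hence
    of a measurable set. *)
Definition stretch_set A i k : set Omega :=
  [set w | A (k%:R^-1 *: \sum_(l <- iota i.+1 k) (Z l w : V))].

Lemma measurable_stretch_set A i k : measurable (A : set (borel_rV R d)) ->
  measurable (stretch_set A i k).
Proof.
move=> mA; have mS : measurable_fun setT
    ((fun w => k%:R^-1 *: \sum_(l <- iota i.+1 k) (Z l w : V)) : Omega -> borel_rV R d).
  apply: measurable_fun_rV => j.
  have -> : (fun w => (k%:R^-1 *: \sum_(l <- iota i.+1 k) (Z l w : V)) 0 j) =
      (fun w => k%:R^-1 * \sum_(l <- iota i.+1 k) (Z l w : V) 0 j).
    by apply/funext => w; rewrite mxE summxE.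
  apply: measurable_funM => //; apply: measurable_sum => l.
  by apply: (measurableT_comp (f := fun x : borel_rV R d => (x : V) 0 j)) => //; exact: measurable_coord.
by have := mS measurableT A mA; rewrite setTI.
Qed.

Definition stretch_event A t n : set Omega :=
  [set w | t < n%:R^-1 * (longest_stretch Z A n w)%:R].

Lemma stretch_eventP A t n w : 0 < t -> (0 < n)%N ->
  stretch_event A t n w <->
  exists k i, [/\ (i + k <= n)%N, t * n%:R < k%:R & stretch_set A i k w].
Proof.
move=> t0 n0; have n0' : (0 : R) < n%:R by rewrite ltr0n.
have tn0 : 0 <= t * n%:R by rewrite mulr_ge0// ltW.
have gtE (m : nat) : (t < n%:R^-1 * m%:R) = (t * n%:R < m%:R :> R).
  by rewrite mulrC ltr_pdivlMr.
have predE k i : t * n%:R < k%:R :> R ->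
    [set k%:R *: x | x in A] (walk Z (i + k) w - walk Z i w) <-> stretch_set A i k w.
  move=> kn; have k0 : (k%:R : R) != 0 by rewrite gt_eqF// (le_lt_trans tn0).
  rewrite walk_block /stretch_set /=; split.
    by move=> [x Ax <-]; rewrite scalerA mulVf// scale1r.
  move=> h; exists (k%:R^-1 *: \sum_(l <- iota i.+1 k) (Z l w : V)) => //.
  by rewrite scalerA mulfV// scale1r.
rewrite /stretch_event /= gtE; split.
  pose Q (k : nat) := (k <= n)%N /\ exists2 i, (i <= n - k)%N & [set k%:R *: x | x in A] (walk Z (i + k) w - walk Z i w).
  (* The maximum is attained or takes its default value 0, and 0 cannot exceed t n. *)
  have : longest_stretch Z A n w = 0%N \/ Q (longest_stretch Z A n w).
    rewrite /longest_stretch; apply: (big_ind (fun m => m = 0%N \/ Q m)).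
    - by left.
    - move=> x y hx hy; rewrite /maxn; case: ifP => _; [exact: hy|exact: hx].
    - by move=> k /asboolP h; right; split; [rewrite -ltnS|].
  move=> [->|[kn [i ik h]]] tk; first by move: tk; rewrite ltNge tn0.
  exists (longest_stretch Z A n w), i; split => //; last exact/predE.
  by move: ik; rewrite -(leq_add2r (longest_stretch Z A n w)) subnK.
move=> [k [i [ikn tk h]]]; apply: (lt_le_trans tk); rewrite ler_nat.
have kn : (k < n.+1)%N by rewrite ltnS (leq_trans _ ikn)// leq_addl.
rewrite /longest_stretch.
apply: (@leq_bigmax_cond _ _ (fun k : 'I_n.+1 => nat_of_ord k) (Ordinal kn)).
apply/asboolP; exists i; last exact/predE.
by rewrite /= -(leq_add2r k) subnK// (leq_trans _ ikn)// leq_addl.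
Qed.

Lemma measurable_stretch_event A t n : 0 < t -> (0 < n)%N ->
  measurable (A : set (borel_rV R d)) -> measurable (stretch_event A t n).
Proof.
move=> t0 n0 mA.
rewrite (_ : stretch_event A t n = \bigcup_(p in [set p : nat * nat |
    (p.2 + p.1 <= n)%N /\ t * n%:R < p.1%:R]) stretch_set A p.2 p.1).
  rewrite bigcup_mkcond; apply: countable_bigcupT_measurable => [|p]; first exact: countableP.
  by case: ifP => // _; exact: measurable_stretch_set.
apply/seteqP; split => w.
  by move=> /(stretch_eventP _ _ t0 n0)[k [i [ikn tk h]]]; exists (k, i).
by move=> [[k i] /= [ikn tk] h]; apply/(stretch_eventP _ _ t0 n0); exists k, i.
Qed.

End stretch_event.

(** * Upper and lower asymptotic bounds *)

Section stretch_asymptotics.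
Context {dO : measure_display} {Omega : measurableType dO} {R : realType}.
Context (P : probability Omega R) (d : nat).
Local Notation V := 'rV[R]_d.+1.
Variable Z : nat -> {RV P >-> borel_rV R d}.
Variables (alpha : R) (mu : {measure set borel_ext R d -> \bar R}).
Hypothesis indepZ : mutually_independent Z.
Hypothesis idZ : identically_distributed Z.
Hypothesis alpha_gt1 : 1 < alpha.
Hypothesis rvZ : regularly_varying (Z 0%N) alpha mu.
Hypothesis EZ0 : forall j, ('E_P[fun w => (Z 0%N w : V) 0%R j] = 0)%E.
Variables (t : R) (A : set V).
Hypothesis t01 : 0 < t < 1.
Hypothesis mA : measurable (A : set (borel_rV R d)).
Hypothesis A0 : bounded_away A.

Let alpha_gt0 : 0 < alpha. Proof. exact: lt_trans alpha_gt1. Qed.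
Let t0 : 0 < t. Proof. by case/andP: t01. Qed.
Let radon_mu : radon mu. Proof. by case: rvZ. Qed.
Let mu_oo : mu (~` to_ext setT) = 0%E. Proof. by case: rvZ. Qed.
Let f n := tail (Z 0%N) n%:R.

Definition scaled_event (B : set V) (n l : nat) : set Omega :=
  [set w | B (n%:R^-1 *: (Z l w : V))].

Lemma pr_scaled_event B n l : measurable (B : set (borel_rV R d)) ->
  pr P (scaled_event B n l) = scaled_pr (Z 0%N) n%:R B.
Proof.
move=> mB; have cf : continuous (fun x : V => n%:R^-1 *: x) by exact: scaler_continuous.
have := continuous_rV_measurable_fun cf measurableT mB; rewrite setTI => mB'.
by congr fine; exact: (idZ l 0 mB').
Qed.

Lemma measurable_scaled_event B n l : measurable (B : set (borel_rV R d)) ->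
  measurable (scaled_event B n l).
Proof. exact: measurable_RV_scaled. Qed.

Lemma star_set_closed : closed (star_set A t).
Proof. by apply: closed_dilation => //; exact: closed_closure. Qed.

Lemma star_set_bounded_away : bounded_away (star_set A t).
Proof.
have [dl dl0 Adl] := bounded_away_ball (bounded_away_closure A0).
apply: (@ball_bounded_away _ _ _ (t * dl)); first by rewrite mulr_gt0.
move=> _ [s /= /andP[ts _] [x Ax <-]]; rewrite normrZ.
have s0 : 0 <= s by apply: le_trans (ltW t0) ts.
by rewrite ger0_norm//; apply: ler_pM => //; [exact: ltW|exact: ltW|exact: Adl].
Qed.

(* Off the bad event a block with increment in kA, k > tn, contains exactly one
   jump, and Z_j/n is close to (k/n)A. *)
Lemma stretch_upper (e : R) : 0 < e -> \forall n \near \oo,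
  pr P (stretch_event Z A t n) <= (fmass mu (star_set A t) + e) * (n%:R * f n).
Proof.
move=> e0; have e3 : 0 < e / 3 by lra.
have [dl dl0 Adl] := bounded_away_ball A0.
have [F' [r [r0 [cF' F'0] F'r hF' _]]] :=
  closed_nbhd radon_mu mu_oo star_set_closed star_set_bounded_away e3.
have dt0 : 0 < dl * t by rewrite mulr_gt0.
(* An increment in kA has norm at least dl k > dl t n, so eta < dl t rules out blocks without a
   jump; eta < r puts Z_l / n in the neighbourhood [F'] of the star set. *)
pose eta := Num.min (r / 2) (dl * t / 2).
have eta0 : 0 < eta by rewrite lt_min !divr_gt0.
have eta_r : eta < r by rewrite gt_min; apply/orP; left; lra.
have eta_dt : eta < dl * t by rewrite gt_min; apply/orP; right; lra.
have [L [u [eps [[/andP[eps0 _] Leps] ule _ bad]]]] :=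
  pr_bad_event indepZ idZ alpha_gt1 rvZ EZ0 eta0 ltr01.
have mF' : measurable (F' : set (borel_rV R d)) by exact: measurable_closed_rV.
near=> n.
have n0 : (0 < n)%N by near: n; exact: nbhs_infty_gt.
have n0' : (0 : R) < n%:R by rewrite ltr0n.
have hbad : pr P (bad_event Z n L eps eta (u n)%:R) <= e / 3 * (n%:R * f n).
  by near: n; exact: bad.
have hF : scaled_pr (Z 0%N) n%:R F' <= (fmass mu F' + e / 3) * f n.
  by near: n; exact: (scaled_pr_closed_le alpha_gt0 rvZ cF' F'0 e3).
have hu : (u n)%:R <= eps * n%:R by near: n; exact: ule.
have mE := measurable_stretch_event Z t0 n0 mA.
have mB := measurable_bad_event Z n L eps eta (u n)%:R.
have mU : measurable (\big[setU/set0]_(l <- iota 1 n) scaled_event F' n l).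
  by apply: bigsetU_measurable => l _; exact: measurable_scaled_event.
have sub : stretch_event Z A t n `<=`
    bad_event Z n L eps eta (u n)%:R `|` \big[setU/set0]_(l <- iota 1 n) scaled_event F' n l.
  move=> w /(stretch_eventP _ _ _ t0 n0)[k [i [ikn tk hA]]].
  have [?|nbad] := pselect (bad_event Z n L eps eta (u n)%:R w); first by left.
  right.
  have n2 : ~ two_jumps Z n (eps * n%:R) w by move=> h; apply: nbad; left.
  have nm : ~ many_jumps Z n (u n)%:R L w by move=> h; apply: nbad; right; left.
  have nb : ~ large_block Z n (eta / 2 * n%:R) (u n)%:R w.
    by move=> h; apply: nbad; right; right.
  have u_ge0 : (0 : R) <= (u n)%:R by [].
  have k0 : (0 : R) < k%:R by apply: le_lt_trans tk; rewrite mulr_ge0// ltW.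
  have kn : (k%:R : R) <= n%:R by rewrite ler_nat (leq_trans _ ikn)// leq_addl.
  set S := \sum_(l <- iota i.+1 k) (Z l w : V) in hA.
  have hS : dl * k%:R <= `|S|.
    have := Adl _ hA; rewrite normrZ gtr0_norm ?invr_gt0//.
    by rewrite ler_pdivlMl// mulrC.
  have [l [lik wl]] : exists l, (i < l <= i + k)%N /\ jump Z (eps * n%:R) l w.
    apply: contrapT => nj.
    have := block_no_jump (ltW eps0) u_ge0 hu Leps nm nb ikn.
    have H l : (i < l <= i + k)%N -> ~ jump Z (eps * n%:R) l w.
      by move=> lik wl; apply: nj; exists l.
    move=> /(_ H); rewrite leNgt => /negP; apply; apply: lt_le_trans hS.
    apply: (@lt_trans _ _ (dl * t * n%:R)); first by rewrite ltr_pM2r.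
    by rewrite -mulrA ltr_pM2l.
  have hZ := block_jump (ltW eps0) u_ge0 hu Leps n2 nm nb ikn lik wl.
  have lin : l \in iota 1 n.
    case/andP: lik => il li; rewrite mem_iota add1n ltnS (leq_trans li ikn) andbT.
    exact: leq_ltn_trans il.
  apply: (in_bigU lin).
  apply: (F'r _ (n%:R^-1 *: S)).
    exists (k%:R / n%:R).
      by rewrite /= ler_pdivlMr// (ltW tk) ler_pdivrMr// mul1r.
    exists (k%:R^-1 *: S); first exact: subset_closure.
    by rewrite scalerA mulrAC mulfV ?gt_eqF// mul1r.
  rewrite -scalerBr normrZ gtr0_norm ?invr_gt0// distrC.
  apply: le_lt_trans eta_r; rewrite ler_pdivrMl// mulrC; exact: hZ.
apply: (le_trans (le_pr P mE (measurableU _ _ mB mU) sub)).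
apply: (le_trans (prU_le P mB mU)).
have hU : pr P (\big[setU/set0]_(l <- iota 1 n) scaled_event F' n l) <=
    n%:R * ((fmass mu F' + e / 3) * f n).
  have := @pr_bigU_uniform _ _ _ P _ (iota 1 n) (scaled_event F' n)
    ((fmass mu F' + e / 3) * f n); rewrite size_iota; apply.
    by move=> l; exact: measurable_scaled_event.
  by move=> l _; rewrite pr_scaled_event.
apply: (le_trans (lerD hbad hU)).
have nf0 : 0 <= n%:R * f n by rewrite mulr_ge0// tail_ge0.
have : (fmass mu F' + e / 3) * (n%:R * f n) <= (fmass mu (star_set A t) + e / 3 + e / 3) * (n%:R * f n).
  by apply: ler_wpM2r => //; lra.
have -> : n%:R * ((fmass mu F' + e / 3) * f n) = (fmass mu F' + e / 3) * (n%:R * f n) by ring.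
lra.
Unshelve. all: by end_near. Qed.

Lemma circ_set_open : open (circ_set A t).
Proof.
apply: bigcup_open => s /= /andP[ts _].
have s0 : s != 0 by rewrite gt_eqF// (lt_trans t0).
have -> : [set s *: x | x in A°] = (fun x : V => s^-1 *: x) @^-1` A°.
  apply/seteqP; split => x /=; first by move=> [y Ay <-]; rewrite scalerA mulVf// scale1r.
  by move=> Ax; exists (s^-1 *: x) => //; rewrite scalerA mulfV// scale1r.
by apply: open_comp => [? _|]; [exact: scaler_continuous|exact: open_interior].
Qed.

(* Points whose (m+1)^-1-neighbourhood lies in (k/n)A for an admissible k, for
   every n >= m: a large jump there forces a long stretch whatever the noise. *)
Definition robust_set (m : nat) : set V :=
  [set y | forall n, (m <= n)%N -> (0 < n)%N -> exists k, [/\ (k <= n)%N, t * n%:R < k%:R &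
    forall x, `|x - y| <= m.+1%:R^-1 -> A ((n%:R / k%:R) *: x)]].

Lemma robust_set_mono m m' : (m <= m')%N -> robust_set m `<=` robust_set m'.
Proof.
move=> mm' y hy n m'n n0; have [k [kn tk h]] := hy n (leq_trans mm' m'n) n0.
exists k; split => // x xy; apply: h; apply: (le_trans xy).
by rewrite lef_pV2 ?posrE// ler_nat.
Qed.

(** Already n = m+1 and x = y suffice: (n/k) y lies in [A] for some k > t n. *)
Lemma robust_set_norm dl m y : 0 < dl -> (forall x, A x -> dl <= `|x|) ->
  robust_set m y -> dl * t <= `|y|.
Proof.
move=> dl0 Adl /(_ m.+1 (leqnSn m) isT)[k [kn tk h]].
have k0 : (0 : R) < k%:R by apply: le_lt_trans tk; rewrite mulr_ge0// ltW.
have := Adl _ (h y _); rewrite subrr normr0 invr_ge0 ler0n => /(_ isT).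
rewrite normrZ gtr0_norm ?divr_gt0// mulrAC ler_pdivlMr// => hk.
rewrite -(ler_pM2l (ltr0Sn R m)); apply: le_trans hk.
by rewrite mulrCA ler_pM2l// mulrC ltW.
Qed.

(** For y near s a, the integer part k of s n is admissible: s <= 1 gives k <= n, the strict
    inequality t < s gives k > t n for large n, and k/n differs from s by at most 1/n. *)
Lemma circ_set_robust : circ_set A t `<=` \bigcup_m (robust_set m)°.
Proof.
move=> _ [s /= /andP[ts s1] [a Aa <-]].
have /nbhs_ballP[rho /= rho0 rhoA] : nbhs a A by [].
have s0 : 0 < s by exact: lt_trans ts.
have st0 : 0 < s - t by lra.
(* Three errors of at most kap, namely x - y, y - s a and the rounding of s, are multiplied by n/k
   <= 1/t; the total stays below 3 rho / 4. *)
pose kap := t * rho / 4; have kap0 : 0 < kap by rewrite !(divr_gt0, mulr_gt0).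
have a1 : 0 < `|a| + 1 by rewrite ltr_wpDl.
(* For n > B, the first term gives n (s - t) > 1, hence k > t n after rounding; the second makes |a|
   / n and 1/(m+1) at most kap. *)
pose B := 1 / (s - t) + (`|a| + 1) / kap.
pose m := (Num.bound B).+1.
have B0 : 0 <= B by rewrite addr_ge0// divr_ge0// ltW.
have Bm : B < m%:R.
  apply: lt_trans (archi_boundP B0) _; by rewrite ltr_nat.
exists m => //; rewrite /interior; apply/nbhs_ballP; exists kap => //= y hy n mn n0.
have n0' : (0 : R) < n%:R by rewrite ltr0n.
have Bn : B < n%:R by apply: lt_le_trans Bm _; rewrite ler_nat.
have sn0 : 0 <= s * n%:R by rewrite mulr_ge0// ltW.
have /andP[k1 k2] := truncn_itv sn0.
set k := Num.truncn (s * n%:R) in k1 k2 *.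
have Bst : 1 / (s - t) <= B by rewrite lerDl divr_ge0// ltW.
have Ba : (`|a| + 1) / kap <= B by rewrite lerDr divr_ge0// ltW.
have tk : t * n%:R < k%:R.
  have : 1 / (s - t) < n%:R by exact: le_lt_trans Bn.
  rewrite ltr_pdivrMr// => h; move: k2; rewrite -natr1; nra.
exists k; split => //.
  by rewrite -(ler_nat R); apply: (le_trans k1); rewrite ler_piMl.
have k0 : (0 : R) < k%:R by apply: le_lt_trans tk; rewrite mulr_ge0// ltW.
move=> x xy; apply: rhoA; rewrite -ball_normE /=.
have kn : k%:R != 0 :> R by rewrite gt_eqF.
have -> : a - (n%:R / k%:R) *: x = (n%:R / k%:R) *: ((k%:R / n%:R) *: a - x).
  by rewrite scalerBr scalerA mulrA divfK// divff ?scale1r// gt_eqF.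
rewrite normrZ gtr0_norm ?divr_gt0//.
have h1 : `|x - s *: a| < 2 * kap.
  have hm : m.+1%:R^-1 <= kap.
    rewrite invf_ple ?posrE//; apply: le_trans (_ : m%:R <= _); last by rewrite ler_nat.
    apply: le_trans (ltW Bm); apply: le_trans Ba; rewrite -[leLHS]mul1r ler_pM2r ?invr_gt0//.
    by rewrite lerDr.
  have hy' : `|y - s *: a| < kap by rewrite distrC; move: hy; rewrite -ball_normE.
  have := ler_normD (x - y) (y - s *: a); rewrite addrA subrK => hD.
  apply: (le_lt_trans hD); rewrite mulr_natl mulr2n.
  by apply: ler_ltD => //; exact: le_trans xy hm.
have h2 : `|s - k%:R / n%:R| * `|a| <= kap.
  have sk : `|s - k%:R / n%:R| <= n%:R^-1.
    rewrite ger0_norm; last by rewrite subr_ge0 ler_pdivrMr.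
    rewrite lerBlDr -[X in X + _]mul1r -mulrDl ler_pdivlMr//.
    by rewrite addrC natr1 ltW.
  have an : (`|a| + 1) / kap <= n%:R by exact: le_trans Ba (ltW Bn).
  apply: (@le_trans _ _ (n%:R^-1 * `|a|)); first by rewrite ler_wpM2r.
  rewrite mulrC ler_pdivrMr// mulrC; move: an; rewrite ler_pdivrMr//.
  by apply: le_trans; rewrite lerDl.
have h3 : `|(k%:R / n%:R) *: a - x| < 3 * kap.
  have -> : (k%:R / n%:R) *: a - x = - ((s - k%:R / n%:R) *: a + (x - s *: a)).
    by rewrite scalerBl opprD !opprB addrA subrK.
  rewrite normrN; apply: (le_lt_trans (ler_normD _ _)); rewrite normrZ; lra.
have h4 : n%:R / k%:R <= t^-1.
  by rewrite ler_pdivrMr// mulrC ler_pdivlMr// mulrC ltW.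
apply: (@le_lt_trans _ _ (t^-1 * (3 * kap))).
  by apply: ler_pM; rewrite ?divr_ge0// ltW.
have trho : 0 < t * rho by rewrite mulr_gt0.
by rewrite /kap ltr_pdivrMl//; lra.
Qed.

(* Bonferroni: P(U E_i) >= sum P(E_i) - sum over pairs of P(E_i n E_j). *)
Lemma pr_bigU_ge (s : seq nat) (E : nat -> set Omega) (p : R) : 0 <= p ->
  uniq s -> (forall l, measurable (E l)) -> (forall l, pr P (E l) = p) ->
  (forall l j, l != j -> pr P (E l `&` E j) <= p ^+ 2) ->
  (size s)%:R * p - ((size s)%:R * p) ^+ 2 <= pr P (\big[setU/set0]_(l <- s) E l).
Proof.
move=> p0 + mE pE pEE; elim: s => [_|i s IH /= /andP[nis us]].
  by rewrite big_nil /pr measure0 !mul0r expr0n subr0.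
rewrite big_cons; set B := \big[setU/set0]_(l <- s) E l in IH *.
have mB : measurable B by exact: bigsetU_measurable.
have hB := IH us.
have hI : pr P (E i `&` B) <= (size s)%:R * p ^+ 2.
  have -> : E i `&` B = \big[setU/set0]_(l <- s) (E i `&` E l) by rewrite /B big_distrr.
  apply: pr_bigU_uniform; first by move=> l; exact: measurableI.
  by move=> l ls; apply: pEE; apply: contraNneq nis => ->.
have hU : pr P (E i `|` B) = pr P (E i) + (pr P B - pr P (E i `&` B)).
  have mD : measurable (B `\` E i) by exact: measurableD.
  have mI : measurable (E i `&` B) by exact: measurableI.
  have e1 : pr P (E i `|` B) = pr P (E i) + pr P (B `\` E i).
    have disj : E i `&` (B `\` E i) = set0 by apply/seteqP; split => // w [? []].
    have -> : E i `|` B = E i `|` (B `\` E i) by rewrite setUDr setDv setD0.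
    by rewrite /pr measureU// fineD//; exact: fin_num_measure.
  have e2 : pr P B = pr P (B `\` E i) + pr P (E i `&` B).
    by apply: EFin_inj; rewrite EFinD !prE//; rewrite setIC; exact: measureDI.
  by rewrite e1 e2; lra.
rewrite hU pE -natr1 !expr2 in hB hI *.
set q : R := (size s)%:R in hB hI *.
have q0 : 0 <= q by rewrite /q.
have := mulr_ge0 p0 p0; nra.
Qed.

Lemma pr_scaled_event2 B n l j : measurable (B : set (borel_rV R d)) -> l != j ->
  pr P (scaled_event B n l `&` scaled_event B n j) = scaled_pr (Z 0%N) n%:R B ^+ 2.
Proof.
move=> mB lj; have cf : continuous (fun x : V => n%:R^-1 *: x) by exact: scaler_continuous.
have := continuous_rV_measurable_fun cf measurableT mB; rewrite setTI => mB'.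
have us : uniq [:: l; j] by rewrite /= inE lj.
have := indepZ us (fun _ => mB'); rewrite big_cons big_seq1 => h.
have -> : scaled_event B n l `&` scaled_event B n j =
    \bigcap_(i in [set` [:: l; j]]) Z i @^-1` ((fun x : V => n%:R^-1 *: x) @^-1` B).
  apply/seteqP; split => w.
    by move=> [wl wj] i /=; rewrite !inE => /orP[/eqP->|/eqP->].
  by move=> h'; split; apply: h' => /=; rewrite !inE eqxx ?orbT.
by rewrite /pr h /= expr2; congr (_ * _); exact: pr_scaled_event.
Qed.

Lemma stretch_lower (e : R) : 0 < e -> \forall n \near \oo,
  (fmass mu (circ_set A t) - e) * (n%:R * f n) <= pr P (stretch_event Z A t n).
Proof.
move=> e0; have e4 : 0 < e / 4 by lra.
(* A quarter of e each goes to the exhaustion by the sets [U m], the portmanteau bound, Bonferroni's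
   error and the bad event. *)
have arith (a b N q v s' c : R) : (a - e / 4) * N <= b * N -> (b - e / 4) * N <= q ->
    q ^+ 2 <= e / 4 * N -> q - q ^+ 2 <= v -> v <= s' + c -> c <= e / 4 * N ->
    (a - e) * N <= s' by lra.
have [dl dl0 Adl] := bounded_away_ball A0.
have dt0 : 0 < dl * t by rewrite mulr_gt0.
pose U m := (robust_set m)°.
have Udt m y : U m y -> dl * t <= `|y|.
  by move=> /interior_subset; exact: robust_set_norm.
have oU m : open (U m) by exact: open_interior.
have UU0 : bounded_away (\bigcup_m U m).
  by apply: (ball_bounded_away dt0) => y [m _]; exact: Udt.
have Umono : {homo U : m m' / (m <= m')%N >-> m `<=` m'}.
  by move=> m m' mm'; apply: interiorS; exact: robust_set_mono.
have [m hm] := fmass_bigcup radon_mu oU Umono UU0 e4.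
have oUU : open (\bigcup_m U m) by exact: bigcup_open.
have circU : fmass mu (circ_set A t) <= fmass mu (\bigcup_m U m).
  apply: (le_fmass radon_mu) => //; last exact: circ_set_robust.
    by apply: measurable_to_ext_open; exact: circ_set_open.
  exact: measurable_to_ext_open.
have U0 : bounded_away (U m) by apply: bounded_awayS UU0; exact: bigcup_sup.
have mUm : measurable (U m : set (borel_rV R d)) by exact: measurable_open_rV.
have eta0 : (0 : R) < m.+1%:R^-1 by rewrite invr_gt0.
have dt2 : 0 < dl * t / 2 by rewrite divr_gt0.
(* eta = 1/(m+1) is the noise that [robust_set m] tolerates; eps <= dl t / 2 makes every Z_l / n in
   [U m], of norm at least dl t, a jump beyond eps n. *)
have [L [u [eps [[/andP[eps0 eps_dt] Leps] ule two bad]]]] :=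
  pr_bad_event indepZ idZ alpha_gt1 rvZ EZ0 eta0 dt2.
have eps_lt : eps < dl * t.
  by apply: (le_lt_trans eps_dt); rewrite gtr_pMr// invf_lt1 ?ltr1n.
near=> n.
have n0 : (0 < n)%N by near: n; exact: nbhs_infty_gt.
have mn : (m <= n)%N by near: n; exact: nbhs_infty_ge.
have n0' : (0 : R) < n%:R by rewrite ltr0n.
have hbad : pr P (bad_event Z n L eps m.+1%:R^-1 (u n)%:R) <= e / 4 * (n%:R * f n).
  by near: n; exact: bad.
have htwo : (n%:R * tail (Z 0%N) (eps * n%:R)) ^+ 2 <= e / 4 * (n%:R * f n).
  by near: n; exact: two.
have hU : (fmass mu (U m) - e / 4) * f n <= scaled_pr (Z 0%N) n%:R (U m).
  by near: n; exact: (scaled_pr_open_ge alpha_gt0 rvZ (oU m) U0 e4).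
have hu : (u n)%:R <= eps * n%:R by near: n; exact: ule.
have mE := measurable_stretch_event Z t0 n0 mA.
have mB := measurable_bad_event Z n L eps m.+1%:R^-1 (u n)%:R.
have mW : measurable (\big[setU/set0]_(l <- iota 1 n) scaled_event (U m) n l).
  by apply: bigsetU_measurable => l _; exact: measurable_scaled_event.
have far l w : scaled_event (U m) n l w -> jump Z (eps * n%:R) l w.
  move=> /Udt; rewrite normrZ gtr0_norm ?invr_gt0// ler_pdivlMl// mulrC => h.
  apply: lt_le_trans (norm_le_enorm _); apply: lt_le_trans h.
  by rewrite ltr_pM2r.
have sub : \big[setU/set0]_(l <- iota 1 n) scaled_event (U m) n l `<=`
    stretch_event Z A t n `|` bad_event Z n L eps m.+1%:R^-1 (u n)%:R.
  move=> w; rewrite -bigcup_seq => -[l /= lin wl].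
  have [?|nbad] := pselect (bad_event Z n L eps m.+1%:R^-1 (u n)%:R w); first by right.
  left.
  have n2 : ~ two_jumps Z n (eps * n%:R) w by move=> h; apply: nbad; left.
  have nm : ~ many_jumps Z n (u n)%:R L w by move=> h; apply: nbad; right; left.
  have nb : ~ large_block Z n (m.+1%:R^-1 / 2 * n%:R) (u n)%:R w.
    by move=> h; apply: nbad; right; right.
  have u_ge0 : (0 : R) <= (u n)%:R by [].
  have [k [kn tk h]] : exists k, [/\ (k <= n)%N, t * n%:R < k%:R &
      forall x, `|x - n%:R^-1 *: (Z l w : V)| <= m.+1%:R^-1 -> A ((n%:R / k%:R) *: x)].
    by move: wl => /interior_subset; exact.
  have k0 : (0 : R) < k%:R by apply: le_lt_trans tk; rewrite mulr_ge0// ltW.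
  have k0' : (0 < k)%N by rewrite -(ltr0n R).
  move: lin; rewrite mem_iota add1n ltnS => /andP[l0 ln].
  (* the truncated difference l - k starts at 0 the block containing an early jump *)
  have ikn : (l - k + k <= n)%N by clear -kn ln; lia.
  have lik : (l - k < l <= l - k + k)%N by clear -l0 k0'; lia.
  apply/(stretch_eventP _ _ _ t0 n0); exists k, (l - k)%N; split => //.
  have hZ := block_jump (ltW eps0) u_ge0 hu Leps n2 nm nb ikn lik (far _ _ wl).
  rewrite /stretch_set /=; set S := \sum_(_ <- _) _ in hZ *.
  have -> : k%:R^-1 *: S = (n%:R / k%:R) *: (n%:R^-1 *: S).
    by rewrite scalerA mulrAC mulfV ?mul1r// gt_eqF.
  apply: h; rewrite -scalerBr normrZ gtr0_norm ?invr_gt0//.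
  by rewrite ler_pdivrMl// mulrC.
set p := scaled_pr (Z 0%N) n%:R (U m) in hU.
have p0 : 0 <= p by exact: pr_ge0.
have pT : p <= tail (Z 0%N) (eps * n%:R).
  rewrite /p -(pr_scaled_event n 0 mUm); apply: le_pr.
  - exact: measurable_scaled_event.
  - exact: measurable_enorm_gt.
  - exact: far.
have np2 : (n%:R * p) ^+ 2 <= e / 4 * (n%:R * f n).
  by apply: le_trans htwo; rewrite ler_sqr ?nnegrE ?mulr_ge0 ?tail_ge0// ler_pM2l.
have hW : n%:R * p - (n%:R * p) ^+ 2 <=
    pr P (\big[setU/set0]_(l <- iota 1 n) scaled_event (U m) n l).
  have := @pr_bigU_ge (iota 1 n) (scaled_event (U m) n) p p0 (iota_uniq _ _).
  rewrite size_iota; apply.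
  - by move=> l; exact: measurable_scaled_event.
  - by move=> l; exact: pr_scaled_event.
  - by move=> l j lj; rewrite pr_scaled_event2.
have hsub := le_trans (le_pr P mW (measurableU _ _ mE mB) sub) (prU_le P mE mB).
have nf0 : 0 <= n%:R * f n by rewrite mulr_ge0// tail_ge0.
have hnp : (fmass mu (U m) - e / 4) * (n%:R * f n) <= n%:R * p.
  by rewrite mulrCA ler_pM2l.
have hc : (fmass mu (circ_set A t) - e / 4) * (n%:R * f n) <= fmass mu (U m) * (n%:R * f n).
  by apply: ler_wpM2r => //; apply: le_trans hm; rewrite lerD2r.
exact: arith hc hnp np2 hW hsub hbad.
Unshelve. all: by end_near. Qed.

End stretch_asymptotics.

(* Z 0 is the generic vector of the i.i.d. family, Z 1, Z 2, ... are the steps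
   of the walk. *)
Theorem theorem4p1 (R : realType) (d : nat) (dO : measure_display)
    (Omega : measurableType dO) (P : probability Omega R)
    (Z : nat -> {RV P >-> borel_rV R d}) (alpha : R)
    (mu : {measure set borel_ext R d -> \bar R})
    (indepZ : mutually_independent Z)
    (idZ : identically_distributed Z)
    (alpha_gt1 : 1 < alpha)
    (rvZ : regularly_varying (Z 0%N) alpha mu)
    (EZ0 : forall j, ('E_P[fun w => (Z 0%N w : 'rV[R]_d.+1) 0%R j] = 0)%E)
    (t : R) (t01 : 0 < t < 1)
    (A : set 'rV[R]_d.+1) (mA : measurable (A : set (borel_rV R d)))
    (A0 : bounded_away A) :
  [/\ (mu (to_ext (circ_set A t)) <=
         limn_einf (stretch_ratio Z A t))%E,
      (limn_einf (stretch_ratio Z A t) <=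
         limn_esup (stretch_ratio Z A t))%E &
      (limn_esup (stretch_ratio Z A t) <=
         mu (to_ext (star_set A t)))%E].
Proof.
have radon_mu : radon mu by case: rvZ.
have t0 : 0 < t by case/andP: t01.
have tail0 n : (0 < n)%N -> 0 < n%:R * tail (Z 0%N) n%:R.
  by move=> n0; rewrite mulr_gt0 ?ltr0n// (tail_gt0 rvZ).
have circ0 : bounded_away (circ_set A t).
  apply: bounded_awayS (star_set_bounded_away t01 A0).
  move=> _ [s /= /andP[ts s1] [x Ax <-]]; exists s; first by rewrite /= ltW.
  by exists x => //; apply: subset_closure; exact: interior_subset.
split; last 2 first.
- exact: limn_einf_sup.
- rewrite -(fmassE radon_mu); first last.
  + exact: (star_set_bounded_away t01).
  + by apply: measurable_to_ext_closed; exact: star_set_closed.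
  apply: limn_esup_le => e e0; near=> n.
  have n0 : (0 < n)%N by near: n; exact: nbhs_infty_gt.
  rewrite ler_pdivrMr; last exact: tail0.
  by near: n; exact: (stretch_upper indepZ idZ alpha_gt1 rvZ EZ0 t01 mA A0 e0).
- rewrite -(fmassE radon_mu) //.
    apply: le_limn_einf => e e0; near=> n.
    have n0 : (0 < n)%N by near: n; exact: nbhs_infty_gt.
    rewrite ler_pdivlMr; last exact: tail0.
    by near: n; exact: (stretch_lower indepZ idZ alpha_gt1 rvZ EZ0 t01 mA A0 e0).
  by apply: measurable_to_ext_open; exact: (circ_set_open t01).
Unshelve. all: by end_near. Qed.
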